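(* Assume projective determinacy (PD). For each $n\in\omega$, there is a universal $\Pi^1_{2n+1}$ set for $\mathbf{\Pi}^1_{2n+1}$ equivalence relations on $2^\omega$; that is, there is a (lightface) $\Pi^1_{2n+1}$ set $\mathcal E\subseteq 2^\omega\times 2^\omega\times 2^\omega$ such that the cross-sections $\mathcal E_\tau=\{(x,y)\in 2^\omega\times 2^\omega : (\tau,x,y)\in\mathcal E\}$, $\tau\in 2^\omega$, are exactly the $\mathbf{\Pi}^1_{2n+1}$ equivalence relations on $2^\omega$ (every $\mathcal E_\tau$ is a $\mathbf{\Pi}^1_{2n+1}$ equivalence relation on $2^\omega$, and every $\mathbf{\Pi}^1_{2n+1}$ equivalence relation on $2^\omega$ equals $\mathcal E_\tau$ for some $\tau\in 2^\omega$).
   Context: PD is the assertion that every two-player perfect-information game of length $\omega$ on $\omega$ with projective payoff set is determined. Boldface $\mathbf{\Pi}^1_{2n+1}$ denotes the classical projective class; lightface $\Pi^1_{2n+1}$ denotes its effective counterpart (the parameter-free analytical class) on recursively presented Polish spaces. An equivalence relation on $2^\omega$ is $\mathbf{\Pi}^1_{2n+1}$ if it is a $\mathbf{\Pi}^1_{2n+1}$ subset of $2^\omega\times 2^\omega$. *)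

(* Defs.v *)
From HB Require Import structures.
From Stdlib Require Export RelationClasses.
From mathcomp Require Export all_boot all_classical all_reals all_analysis.

Set Implicit Arguments.
Unset Strict Implicit.
Unset Printing Implicit Defensive.

Local Open Scope classical_set_scope.

Definition baire_space : Type := prod_topology (fun _ : nat => nat).
HB.instance Definition _ := Topological.copy baire_space
  (prod_topology (fun _ : nat => nat)).

(** Boldface projective classes: level 0 is the class of open sets, and
    Sigma^1_(k+1) sets are the projections along the Baire space of Pi^1_k
    sets.  In particular Sigma^1_1 sets are the projections of closed sets. *)
Fixpoint bold_Sigma1 (k : nat) (T : topologicalType) (A : set T) : Prop :=
  if k is k'.+1 then
    exists B : set (T * baire_space),
      bold_Sigma1 k' (~` B) /\ A = [set x | exists f, B (x, f)]
  else open A.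

Definition bold_Pi1 (k : nat) (T : topologicalType) (A : set T) : Prop :=
  bold_Sigma1 k (~` A).

Definition projective (T : topologicalType) (A : set T) : Prop :=
  exists k, bold_Sigma1 k A.

(** Games on nat: a play is an infinite sequence x, player I choosing the
    even-indexed terms and player II the odd-indexed ones.  A strategy maps the
    finite sequence of all previous moves, of both players, to the next move;
    player I wins the play x if x lies in the payoff set. *)
Definition strategy := seq nat -> nat.

Definition follows_I (s : strategy) (x : baire_space) : Prop :=
  forall n, ~~ odd n -> x n = s (mkseq x n).

Definition follows_II (s : strategy) (x : baire_space) : Prop :=
  forall n, odd n -> x n = s (mkseq x n).

Definition determined (A : set baire_space) : Prop :=
  (exists s, forall x, follows_I s x -> A x) \/
  (exists s, forall x, follows_II s x -> ~ A x).

Definition PD : Prop := forall A : set baire_space, projective A -> determined A.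

(** Arithmetical formulas of second-order arithmetic, with number variables and
    unary function variables, the latter never quantified.  Both kinds of
    variables are de Bruijn indices; [ar_all] binds number variable 0.  Indices
    beyond the environment denote 0, resp. the zero function, so that formulas
    never carry parameters. *)
Inductive ar_term : Type :=
  | ar_var of nat
  | ar_zero
  | ar_succ of ar_term
  | ar_add of ar_term & ar_term
  | ar_mul of ar_term & ar_term
  | ar_app of nat & ar_term.

Inductive ar_formula : Type :=
  | ar_eq of ar_term & ar_term
  | ar_not of ar_formula
  | ar_and of ar_formula & ar_formula
  | ar_all of ar_formula.

Fixpoint ar_eval (F : seq (nat -> nat)) (e : seq nat) (t : ar_term) : nat :=
  match t with
  | ar_var i => nth 0 e i
  | ar_zero => 0
  | ar_succ t1 => (ar_eval F e t1).+1
  | ar_add t1 t2 => ar_eval F e t1 + ar_eval F e t2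
  | ar_mul t1 t2 => ar_eval F e t1 * ar_eval F e t2
  | ar_app i t1 => nth (fun=> 0) F i (ar_eval F e t1)
  end.

Fixpoint ar_holds (F : seq (nat -> nat)) (e : seq nat) (p : ar_formula) : Prop :=
  match p with
  | ar_eq t1 t2 => ar_eval F e t1 = ar_eval F e t2
  | ar_not q => ~ ar_holds F e q
  | ar_and q r => ar_holds F e q /\ ar_holds F e r
  | ar_all q => forall n, ar_holds F (n :: e) q
  end.

(** Truth of the formula obtained by prefixing p with k alternating function
    quantifiers, the outermost being existential (Sigma), resp. universal (Pi).
    The innermost quantifier binds function variable 0 of p. *)
Fixpoint Sigma1_holds (k : nat) (F : seq (nat -> nat)) (p : ar_formula) : Prop :=
  if k is k'.+1 then exists f, Pi1_holds k' (f :: F) p else ar_holds F [::] p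
with Pi1_holds (k : nat) (F : seq (nat -> nat)) (p : ar_formula) : Prop :=
  if k is k'.+1 then forall f, Sigma1_holds k' (f :: F) p else ar_holds F [::] p.

(** A point of the Cantor space, read as a 0-1 valued function. *)
Definition cantor_fun (x : cantor_space) : nat -> nat := fun n => nat_of_bool (x n).

(** Lightface Pi^1_k subsets of the product of three copies of the Cantor space. *)
Definition light_Pi1 (k : nat)
    (A : set (cantor_space * cantor_space * cantor_space)) : Prop :=
  exists p : ar_formula, forall t x y : cantor_space,
    A (t, x, y) <-> Pi1_holds k [:: cantor_fun t; cantor_fun x; cantor_fun y] p.

Definition equivalence_set (T : Type) (R : set (T * T)) : Prop :=
  Equivalence (fun x y => R (x, y)).

Definition cross_section (T U V : Type) (A : set (T * U * V)) (t : T) : set (U * V) :=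
  [set xy | A (t, xy.1, xy.2)].

(* Main.v *)
Require Import Defs.
From mathcomp Require Import zify.

(** Let W be a universal Pi^1_(2n+1) set. By the first periodicity theorem (PD)
    it carries a Pi^1_(2n+1) norm, with its relation q <* p. Given a code a and a
    pair s, generate pairs from s by adding every p with not (q <* p), q being
    s or already generated, and closing under symmetry and transitivity; define
    E_a(x, y) to hold iff x = y or all the pairs generated from (x, y) lie in
    W_a. As long as only pairs of W_a are generated, not (q <* p) says that p is
    in W_a with norm at most that of q. So the sets generated from good pairs are
    initial segments of W_a, nested, symmetric and transitive: their union E_a
    is always an equivalence relation, and it is W_a if W_a is one. Generation is
    Sigma^1_(2n+1) because q <* p occurs negatively, so E is Pi^1_(2n+1). *)

Set Implicit Arguments.
Unset Strict Implicit.
Unset Printing Implicit Defensive.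

Local Open Scope classical_set_scope.

(** * Arithmetical predicates *)

(** Selecting the codes whose section is an equivalence relation is too expensive: transitivity of
    W_a has W on both sides of an implication, so it is a priori only Pi^1_(2n+2). Hence every code
    is repaired by a uniform operation that fixes the good ones. The rules cannot ask whether a pair
    is in W_a, for W would then occur positively in a Sigma^1_(2n+1) definition; the norm answers
    this negatively. For q outside W_a, q <* p fails for every p, so a bad pair generates
    everything, which is harmless because the start is refuted by then. The clause x = y is there
    because (x, x) may lie outside W_a. *)

(* The functions assigned to the function variables. Total environments, unlike
   the lists of [ar_holds], make shifting a variable a conversion. *)
Definition env := nat -> nat -> nat.

Definition scons (A : Type) (x : A) (s : nat -> A) : nat -> A :=
  fun i => if i is j.+1 then s j else x.

Notation "x ::: s" := (scons x s) (at level 60, right associativity).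

Lemma scons_eta (A : Type) (s : nat -> A) : s 0 ::: (fun i => s i.+1) = s.
Proof. by apply/funext => -[]. Qed.

Fixpoint tev (F : env) (e : nat -> nat) (t : ar_term) : nat :=
  match t with
  | ar_var i => e i
  | ar_zero => 0
  | ar_succ t1 => (tev F e t1).+1
  | ar_add t1 t2 => tev F e t1 + tev F e t2
  | ar_mul t1 t2 => tev F e t1 * tev F e t2
  | ar_app i t1 => F i (tev F e t1)
  end.

Fixpoint fev (F : env) (e : nat -> nat) (p : ar_formula) : Prop :=
  match p with
  | ar_eq t1 t2 => tev F e t1 = tev F e t2
  | ar_not q => ~ fev F e q
  | ar_and q r => fev F e q /\ fev F e r
  | ar_all q => forall n, fev F (n ::: e) q
  end.

Definition nthf (F : seq (nat -> nat)) : env := nth (fun=> 0) F.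

Lemma nth_cons_scons (A : Type) (d x : A) (s : seq A) :
  nth d (x :: s) = x ::: nth d s.
Proof. by apply/funext => -[]. Qed.

Lemma ar_eval_tev F e t : ar_eval F e t = tev (nthf F) (nth 0 e) t.
Proof.
by elim: t => //= [t ->|t -> u ->|t -> u ->|i t ->].
Qed.

Lemma ar_holds_fev F e p : ar_holds F e p <-> fev (nthf F) (nth 0 e) p.
Proof.
elim: p e => /= [t u e|p IH e|p IHp q IHq e|p IH e].
- by rewrite !ar_eval_tev.
- by split => h /IH.
- by split => -[/IHp hp /IHq hq].
- by split => h n; [rewrite -nth_cons_scons|move: (h n); rewrite -nth_cons_scons];
     move=> *; apply/IH.
Qed.

Definition Tm (f : env -> (nat -> nat) -> nat) : Prop :=
  exists t, forall F e, f F e = tev F e t.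

Definition Ar (P : env -> (nat -> nat) -> Prop) : Prop :=
  exists p, forall F e, P F e <-> fev F e p.

Lemma Tm_var i : Tm (fun F e => e i).
Proof. by exists (ar_var i). Qed.

Lemma Tm_const n : Tm (fun F e => n).
Proof. by elim: n => [|n [t h]]; [exists ar_zero|exists (ar_succ t) => F e /=; rewrite -h]. Qed.

Lemma Tm_succ f : Tm f -> Tm (fun F e => (f F e).+1).
Proof. by case=> t h; exists (ar_succ t) => F e /=; rewrite h. Qed.

Lemma Tm_add f g : Tm f -> Tm g -> Tm (fun F e => f F e + g F e).
Proof. by case=> t h [u h']; exists (ar_add t u) => F e /=; rewrite h h'. Qed.

Lemma Tm_mul f g : Tm f -> Tm g -> Tm (fun F e => f F e * g F e).
Proof. by case=> t h [u h']; exists (ar_mul t u) => F e /=; rewrite h h'. Qed.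

Lemma Tm_app i f : Tm f -> Tm (fun F e => F i (f F e)).
Proof. by case=> t h; exists (ar_app i t) => F e /=; rewrite h. Qed.

Lemma Ar_ext P Q : (forall F e, P F e <-> Q F e) -> Ar P -> Ar Q.
Proof. by move=> h [p hp]; exists p => F e; rewrite -h. Qed.

Lemma Ar_eq f g : Tm f -> Tm g -> Ar (fun F e => f F e = g F e).
Proof. by case=> t h [u h']; exists (ar_eq t u) => F e /=; rewrite h h'. Qed.

Lemma Ar_not P : Ar P -> Ar (fun F e => ~ P F e).
Proof. by case=> p h; exists (ar_not p) => F e /=; rewrite h. Qed.

Lemma Ar_and P Q : Ar P -> Ar Q -> Ar (fun F e => P F e /\ Q F e).
Proof. by case=> p h [q h']; exists (ar_and p q) => F e /=; rewrite h h'. Qed.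

Lemma Ar_or P Q : Ar P -> Ar Q -> Ar (fun F e => P F e \/ Q F e).
Proof.
move=> hP hQ; apply: Ar_ext (Ar_not (Ar_and (Ar_not hP) (Ar_not hQ))) => F e.
by split=> [/not_andP[/contrapT|/contrapT]|[h|h] []]; tauto.
Qed.

Lemma Ar_imp P Q : Ar P -> Ar Q -> Ar (fun F e => P F e -> Q F e).
Proof.
move=> hP hQ; apply: Ar_ext (Ar_or (Ar_not hP) hQ) => F e.
by have := EM (P F e); tauto.
Qed.

Lemma Ar_all P : Ar (fun F e => P F (fun i => e i.+1) (e 0)) ->
  Ar (fun F e => forall n, P F e n).
Proof.
case=> p h; exists (ar_all p) => F e; split=> k n.
  by apply: (proj1 (h F (n ::: e))); apply: k.
by apply: (proj2 (h F (n ::: e))); apply: k.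
Qed.

Lemma Ar_exn P : Ar (fun F e => P F (fun i => e i.+1) (e 0)) ->
  Ar (fun F e => exists n, P F e n).
Proof.
move=> h; apply: (@Ar_ext (fun F e => ~ forall n, ~ P F e n)).
  move=> F e; split=> [/existsNP[n /contrapT hn]|[n hn] k]; first by exists n.
  exact: k hn.
by apply/Ar_not/Ar_all/Ar_not.
Qed.

Lemma Ar_true : Ar (fun F e => True).
Proof. by exists (ar_eq ar_zero ar_zero). Qed.

Lemma Ar_le f g : Tm f -> Tm g -> Ar (fun F e => f F e <= g F e).
Proof.
case=> t h [u h']; apply: (@Ar_ext (fun F e => exists n, f F e + n = g F e)).
  by move=> F e; split=> [[n]|]; [lia|exists (g F e - f F e); lia].
have [p hp] : Ar (fun F e => exists n, f F e + n = g F e); last by exists p.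
have s v : Tm (fun F e => tev F (fun i => e i.+1) v).
  elim: v => /= [i||v|v hv w|v hv w|i v].
  - exact: Tm_var.
  - exact: Tm_const.
  - exact: Tm_succ.
  - exact: Tm_add.
  - exact: Tm_mul.
  - exact: Tm_app.
apply: Ar_exn; apply: (@Ar_ext (fun F e => tev F (fun i => e i.+1) t + e 0
   = tev F (fun i => e i.+1) u)) => [F e|]; first by rewrite h h'.
by apply: Ar_eq => //; apply: Tm_add => //; exact: Tm_var.
Qed.

Lemma Ar_lt f g : Tm f -> Tm g -> Ar (fun F e => f F e < g F e).
Proof. by move=> hf; exact: Ar_le (Tm_succ hf). Qed.

Definition upren (r : nat -> nat) : nat -> nat :=
  fun i => if i is j.+1 then (r j).+1 else 0.

Lemma Tm_ren r f : Tm f -> Tm (fun F e => f F (fun i => e (r i))).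
Proof.
case=> t h; suff: Tm (fun F e => tev F (fun i => e (r i)) t).
  by case=> u k; exists u => F e; rewrite -k h.
elim: t {h} => /= [i||v|v hv w|v hv w|i v].
- exact: Tm_var.
- exact: Tm_const.
- exact: Tm_succ.
- exact: Tm_add.
- exact: Tm_mul.
- exact: Tm_app.
Qed.

Lemma Ar_ren r P : Ar P -> Ar (fun F e => P F (fun i => e (r i))).
Proof.
case=> p h; suff: Ar (fun F e => fev F (fun i => e (r i)) p).
  by apply: Ar_ext => F e; rewrite h.
elim: p r {h} => /= [t u|p IH|p IHp q IHq|p IH] r.
- apply: Ar_eq; first by apply: (@Tm_ren r (fun F e => tev F e t)); exists t.
  by apply: (@Tm_ren r (fun F e => tev F e u)); exists u.
- exact: Ar_not.
- exact: Ar_and.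
- apply: Ar_all; apply: Ar_ext (IH (upren r)) => F e.
  by rewrite (_ : (fun i => e (upren r i)) = e 0 ::: (fun i => e (r i).+1)) //;
    apply/funext => -[].
Qed.

(* Composite terms are flattened by existentially quantifying the values of
   their subterms, so that only the graphs of the substituted functions have to
   be arithmetical. *)
Lemma Ar_sub (G : env -> (nat -> nat) -> env) P :
  (forall i, Ar (fun F e => G F (fun j => e j.+2) i (e 0) = e 1)) ->
  Ar P -> Ar (fun F e => P (G F e) e).
Proof.
move=> hG [p h]; suff: Ar (fun F e => fev (G F e) e p).
  by apply: Ar_ext => F e; rewrite h.
elim: p {h} G hG => /= [t u|p IH|p IHp q IHq|p IH] G hG.
- pose val v := fun F e => tev (G F (fun i => e i.+1)) (fun i : nat => e i.+1) v.
  have bin op v w : Ar (fun F e => op (e 1) (e 0) = e 2) ->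
      Ar (fun F e => val v F e = e 0) -> Ar (fun F e => val w F e = e 0) ->
      Ar (fun F e => op (val v F e) (val w F e) = e 0).
    move=> hop hv hw; apply: (@Ar_ext (fun F e => exists n m,
        val v F e = n /\ (val w F e = m /\ op n m = e 0))).
      by move=> F e; split=> [[n [m [-> [->]]]]|] //; do 2 eexists; split; [|split]; reflexivity || assumption.
    apply: Ar_exn; apply: Ar_exn.
    apply: Ar_and; first exact: (Ar_ren (fun i => if i is j.+1 then j.+3 else 1) hv).
    apply: Ar_and; first exact: (Ar_ren (fun i => if i is j.+1 then j.+3 else 0) hw).
    exact: hop.
  have tm v : Ar (fun F e => tev (G F (fun i => e i.+1)) (fun i => e i.+1) v = e 0).
    elim: v => /= [i||v IHv|v IHv w IHw|v IHv w IHw|i v IHv].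
    + by apply: Ar_eq; exact: Tm_var.
    + by apply: Ar_eq; [exact: Tm_const|exact: Tm_var].
    + apply: (@Ar_ext (fun F e => exists n,
        tev (G F (fun i => e i.+1)) (fun i => e i.+1) v = n /\ n.+1 = e 0)).
        by move=> F e; split=> [[n [-> ]]|]; last by eexists; split; first reflexivity.
      apply: Ar_exn; apply: Ar_and; first exact: (Ar_ren (fun i => if i is j.+1 then j.+2 else 0) IHv).
      by apply: Ar_eq; [apply: Tm_succ|]; exact: Tm_var.
    + apply: (bin addn) => //; apply: Ar_eq; last exact: Tm_var.
      by apply: Tm_add; exact: Tm_var.
    + apply: (bin muln) => //; apply: Ar_eq; last exact: Tm_var.
      by apply: Tm_mul; exact: Tm_var.
    + apply: (@Ar_ext (fun F e => exists n,
        tev (G F (fun i => e i.+1)) (fun i => e i.+1) v = n /\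
        G F (fun i => e i.+1) i n = e 0)).
        by move=> F e; split=> [[n [-> ]]|]; last by eexists; split; first reflexivity.
      apply: Ar_exn; apply: Ar_and; first exact: (Ar_ren (fun i => if i is j.+1 then j.+2 else 0) IHv).
      exact: hG.
  apply: (@Ar_ext (fun F e => exists n, tev (G F e) e t = n /\ tev (G F e) e u = n)).
    by move=> F e; split=> [[n [-> ->]]|]; last by eexists; split; first reflexivity.
  by apply: Ar_exn; apply: Ar_and; exact: tm.
- by apply: Ar_not; exact: IH.
- by apply: Ar_and; [exact: IHp|exact: IHq].
- apply: Ar_all.
  have := IH (fun F e => G F (fun i => e i.+1)).
  have k i : Ar (fun F e => G F (fun j => e j.+3) i (e 0) = e 1).
    by have := Ar_ren (fun i => if i is j.+2 then j.+3 else i) (hG i).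
  by move/(_ k); apply: Ar_ext => F e; rewrite scons_eta.
Qed.

Ltac ar_tm := repeat first
  [ apply: Tm_const | apply: Tm_var | apply: Tm_succ | apply: Tm_add
  | apply: Tm_mul | apply: Tm_app ].

Ltac ar := repeat first
  [ assumption | apply: Ar_true | apply: Ar_not | apply: Ar_and | apply: Ar_or | apply: Ar_imp
  | apply: Ar_exn | apply: Ar_all
  | (apply: Ar_lt; [by ar_tm|by ar_tm]) | (apply: Ar_le; [by ar_tm|by ar_tm])
  | (apply: Ar_eq; [by ar_tm|by ar_tm]) ].

(** * Goedel's beta function *)

Definition beta (c d i : nat) : nat := c %% (1 + i.+1 * d).

Lemma beta_coprime d m i j : (forall k, 0 < k <= m -> k %| d) ->
  i < j -> j <= m -> coprime (1 + i.+1 * d) (1 + j.+1 * d).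
Proof.
move=> hd ij jm; set g := gcdn (1 + i.+1 * d) (1 + j.+1 * d).
have gd : coprime g d.
  have : coprime (1 + i.+1 * d) d by rewrite /coprime addnC gcdnC gcdnMDl gcdn1.
  by apply: coprime_dvdl; exact: dvdn_gcdl.
have : g %| (j - i) * d.
  have -> : (j - i) * d = (1 + j.+1 * d) - (1 + i.+1 * d) by nia.
  by apply: dvdn_sub; [exact: dvdn_gcdr|exact: dvdn_gcdl].
rewrite Gauss_dvdl // => gji.
have gd' : g %| d by apply: (dvdn_trans gji); apply: hd; lia.
by move: gd; rewrite /coprime => /eqP h; rewrite /coprime -/g -h; apply/eqP/esym/gcdn_idPl.
Qed.

Lemma beta_lemma (b : nat -> nat) m : exists c d, forall i, i < m -> beta c d i = b i.
Proof.
(* All positive numbers up to [m] divide the factorial, so the moduli are pairwise coprime; it also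
   exceeds every [b i], so the remainders are the values themselves. *)
pose s := \sum_(i < m) b i; pose d := (m + s).+1`!.
have hd k : 0 < k <= m -> k %| d by move=> hk; apply: dvdn_fact; lia.
have hb i : i < m -> b i < 1 + i.+1 * d.
  move=> im; have : b i <= s by rewrite /s (bigD1 (Ordinal im)) //= leq_addr.
  have : (m + s).+1 <= d by apply: dvdn_leq; [exact: fact_gt0|apply: dvdn_fact; lia].
  by nia.
suff [c hc] : exists c, forall i, i < m -> c = b i %[mod 1 + i.+1 * d].
  by exists c, d => i im; rewrite /beta hc // modn_small // hb.
suff: forall n, n <= m -> exists c, forall i, i < n -> c = b i %[mod 1 + i.+1 * d].
  by apply.
elim=> [|n IH] nm; first by exists 0.
have [c hc] := IH (ltnW nm).
pose M := \prod_(i < n) (1 + i.+1 * d).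
have co : coprime M (1 + n.+1 * d).
  rewrite /M; elim/big_ind: _ => [|x y hx hy|i _]; first exact: coprime1n.
    by rewrite coprimeMl hx hy.
  by apply: (@beta_coprime d m) => //; lia.
exists (chinese M (1 + n.+1 * d) c (b n)) => i; rewrite ltnS leq_eqVlt => /orP[/eqP->|lt].
  exact: chinese_modr.
rewrite -(hc _ lt); apply/eqP.
have dv : (1 + i.+1 * d) %| M by rewrite /M (bigD1 (Ordinal lt)) //= dvdn_mulr.
have := chinese_modl co c (b n) => h.
by rewrite -(modn_dvdm _ dv) h (modn_dvdm _ dv).
Qed.

Lemma Ar_beta : Ar (fun F e => beta (e 2) (e 3) (e 0) = e 1).
Proof.
apply: (@Ar_ext (fun F e => exists q, e 2 = q * (1 + (e 0).+1 * e 3) + e 1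
   /\ e 1 < 1 + (e 0).+1 * e 3)); last by ar.
move=> F e; rewrite /beta; split=> [[q [-> lt]]|<-].
  by rewrite modnMDl modn_small.
exists (e 2 %/ (1 + (e 0).+1 * e 3)); split; first exact: divn_eq.
by rewrite ltn_mod.
Qed.

(** If each witness matters only through finitely many values, a beta-coded sequence can replace it,
    and the function quantifier becomes two number quantifiers. *)
Lemma Ar_exf (P : env -> (nat -> nat) -> Prop) : Ar P ->
  (forall F e b, P (b ::: F) e -> exists m, forall b', (forall j, j < m -> b j = b' j) ->
     P (b' ::: F) e) ->
  Ar (fun F e => exists b, P (b ::: F) e).
Proof.
move=> hP loc; apply: (@Ar_ext (fun F e => exists d c, P (beta c d ::: F) e)).
  move=> F e; split=> [[d [c h]]|[b h]]; first by exists (beta c d).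
  have [m hm] := loc _ _ _ h; have [c [d hcd]] := beta_lemma b m.
  by exists d, c; apply: hm => j jm; rewrite hcd.
apply: Ar_exn; apply: Ar_exn.
have hP' : Ar (fun F e => P F (fun i => e i.+2)) by exact: (Ar_ren (fun i => i.+2)).
apply: (Ar_sub (G := fun F e => beta (e 0) (e 1) ::: F) _ hP') => -[|i] /=.
  exact: Ar_beta.
by ar.
Qed.

(** * Lightface projective classes *)

Definition agree (m : nat) (F F' : env) : Prop :=
  forall i j, j < m -> F i j = F' i j.

Lemma agreeW m n F F' : m <= n -> agree n F F' -> agree m F F'.
Proof. by move=> mn h i j jm; apply: h; exact: leq_trans mn. Qed.

Lemma agree_sym m F F' : agree m F F' -> agree m F' F.
Proof. by move=> h i j jm; rewrite h. Qed.

Lemma agree_scons m f f' F F' : (forall j, j < m -> f j = f' j) -> agree m F F' ->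
  agree m (f ::: F) (f' ::: F').
Proof. by move=> hf hF [|i] //=; exact: hF. Qed.

(* [P] is the increasing union of the [th n], and [th n F] depends only on the
   first n values of the functions in F. In particular [P] is open, so that the
   effective and the topological hierarchies start from the same kind of sets. *)
Definition S0 (P : env -> Prop) : Prop :=
  exists th : nat -> env -> Prop,
    [/\ Ar (fun F e => th (e 0) F),
        forall m n F, m <= n -> th m F -> th n F,
        forall m F F', agree m F F' -> th m F -> th m F'
      & forall F, P F <-> exists n, th n F].

Fixpoint Sig (k : nat) (P : env -> Prop) : Prop :=
  if k is k'.+1 then
    exists Q, Sig k' (fun F => ~ Q F) /\ forall F, P F <-> exists f, Q (f ::: F)
  else S0 P.

(* [D m n F] certifies that the first m values of the functions in F determine
   the first n values of [g F]. *)
Definition Rec1 (g : env -> nat -> nat) : Prop :=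
  Ar (fun F e => g F (e 0) = e 1) /\
  exists D : nat -> nat -> env -> Prop,
    [/\ Ar (fun F e => D (e 0) (e 1) F),
        forall m m' n F, m <= m' -> D m n F -> D m' n F,
        forall m n F F', agree m F F' -> D m n F ->
          D m n F' /\ forall j, j < n -> g F j = g F' j
      & forall n F, exists m, D m n F].

Definition Rec (T : env -> env) : Prop :=
  (forall i, Ar (fun F e => T F i (e 0) = e 1)) /\
  exists D : nat -> nat -> env -> Prop,
    [/\ Ar (fun F e => D (e 0) (e 1) F),
        forall m m' n F, m <= m' -> D m n F -> D m' n F,
        forall m n F F', agree m F F' -> D m n F -> D m n F' /\ agree n (T F) (T F')
      & forall n F, exists m, D m n F].

Lemma Rec_cons g T : Rec1 g -> Rec T -> Rec (fun F => g F ::: T F).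
Proof.
move=> [hg [D [D1 D2 D3 D4]]] [hT [D' [E1 E2 E3 E4]]]; split.
  by case=> [|i]; [exact: hg|exact: hT].
exists (fun m n F => D m n F /\ D' m n F); split.
- exact: Ar_and.
- by move=> m m' n F mm [h h']; split; [exact: D2 h|exact: E2 h'].
- move=> m n F F' hF [/(D3 _ _ _ _ hF) [? ?] /(E3 _ _ _ _ hF) [? ?]].
  by split=> //; apply: agree_scons.
- move=> n F; have [m hm] := D4 n F; have [m' hm'] := E4 n F.
  exists (maxn m m'); split; [apply: D2 hm|apply: E2 hm']; lia.
Qed.

Lemma Rec_ren r : Rec (fun F i => F (r i)).
Proof.
split=> [i|]; first by ar.
exists (fun m n F => n <= m); split.
- by ar.
- by move=> m m' n _ mm nm; exact: leq_trans mm.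
- by move=> m n F F' hF nm; split=> // i j jn; apply: hF; exact: leq_trans nm.
- by move=> n F; exists n.
Qed.

(** The use of a term: each function value consulted in its evaluation has its argument below [m].
    This provides the certificate [D] for functions given by terms. *)
Fixpoint tbnd (F : env) (e : nat -> nat) (t : ar_term) (m : nat) : Prop :=
  match t with
  | ar_var _ | ar_zero => True
  | ar_succ t1 => tbnd F e t1 m
  | ar_add t1 t2 | ar_mul t1 t2 => tbnd F e t1 m /\ tbnd F e t2 m
  | ar_app _ t1 => tbnd F e t1 m /\ tev F e t1 < m
  end.

Lemma Ar_tbnd t : Ar (fun F e => tbnd F (fun i => e i.+1) t (e 0)).
Proof.
elim: t => //=; try by move=> *; ar.
move=> i t h; apply: Ar_and => //; apply: Ar_lt; last by ar_tm.
by apply: (@Tm_ren S (fun F e => tev F e t)); exists t.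
Qed.

Lemma tbnd_le F e t m m' : m <= m' -> tbnd F e t m -> tbnd F e t m'.
Proof.
move=> mm; elim: t => //= [t IH u IH' []|t IH u IH' []|i t IH []]; try by split; auto.
by move=> h lt; split; [exact: IH|exact: leq_trans mm].
Qed.

Lemma tbnd_agree F F' e t m : agree m F F' -> tbnd F e t m ->
  tev F e t = tev F' e t /\ tbnd F' e t m.
Proof.
move=> hF; elim: t => //= [t IH /IH [-> ?]|t IH u IH' [/IH [-> ?] /IH' [-> ?]]
  |t IH u IH' [/IH [-> ?] /IH' [-> ?]]|i t IH [/IH [<- ?] lt]] //.
by rewrite hF.
Qed.

Lemma tbnd_tot F e t : exists m, tbnd F e t m.
Proof.
elim: t => //=; try by exists 0.
1,2: move=> t [m hm] u [m' hm']; exists (maxn m m');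
  split; [apply: tbnd_le hm|apply: tbnd_le hm']; lia.
move=> i t [m hm]; exists (maxn m (tev F e t).+1); split; last lia.
by apply: tbnd_le hm; lia.
Qed.

Lemma Rec1_tm (g : env -> nat -> nat) : Tm (fun F e => g F (e 0)) -> Rec1 g.
Proof.
case=> t ht.
have eg F n : g F n = tev F (fun=> n) t by rewrite -(ht F (fun=> n)).
split; first by apply: Ar_eq; [exists t|ar_tm].
exists (fun m n F => forall j, j < n -> tbnd F (fun=> j) t m); split.
- apply: (@Ar_ext (fun F e => forall j, j < e 1 ->  tbnd F (fun=> j) t (e 0))) => //.
  apply: Ar_all; apply: Ar_imp; first by ar.
  exact: (Ar_ren (fun i => if i is j.+1 then 0 else 1) (Ar_tbnd t)).
- by move=> m m' n F mm h j jn; apply: tbnd_le (h j jn).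
- move=> m n F F' hF h; split=> j jn; have [h1 h2] := tbnd_agree hF (h j jn) => //.
  by rewrite !eg.
- move=> n F; elim: n => [|n [m hm]]; first by exists 0.
  have [m' hm'] := tbnd_tot F (fun=> n) t.
  exists (maxn m m') => j; rewrite ltnS leq_eqVlt => /orP[/eqP ->|jn].
    by apply: tbnd_le hm'; lia.
  by apply: tbnd_le (hm j jn); lia.
Qed.

Lemma Rec_lift T : Rec T -> Rec (fun F => F 0 ::: T (fun i => F i.+1)).
Proof.
move=> [hT [D [D1 D2 D3 D4]]]; apply: Rec_cons; first by apply: Rec1_tm; ar_tm.
have sh P : Ar P -> Ar (fun F e => P (fun i => F i.+1) e).
  by apply: (Ar_sub (G := fun F e i => F i.+1)) => i; ar.
split; first by move=> i; exact: (sh (fun F e => T F i (e 0) = e 1)).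
exists (fun m n F => D m n (fun i => F i.+1)); split.
- exact: (sh (fun F e => D (e 0) (e 1) F)).
- by move=> m m' n F; exact: D2.
- by move=> m n F F' hF; apply: D3 => i; exact: hF.
- by move=> n F; exact: D4.
Qed.

Lemma S0_sub P T : Rec T -> S0 P -> S0 (fun F => P (T F)).
Proof.
move=> [hT [D [D1 D2 D3 D4]]] [th [t1 t2 t3 t4]].
exists (fun m F => exists n, [/\ n <= m, D m n F & th n (T F)]); split.
- apply: (@Ar_ext (fun F e => exists n, n <= e 0 /\ (D (e 0) n F /\ th n (T F)))).
    by move=> F e; split=> -[n]; [case=> ? [? ?]|case=> ? ? ?]; exists n.
  apply: Ar_exn; apply: Ar_and; first by ar.
  apply: Ar_and; first exact: (Ar_ren (fun i => if i is 0 then 1 else 0) D1).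
  by apply: (Ar_sub (G := fun F e => T F) (P := fun F e => th (e 0) F)).
- move=> m n F mn [n' [le hD ht]]; exists n'; split=> //; first exact: leq_trans mn.
  exact: D2 hD.
- move=> m F F' hF [n [le hD ht]]; have [hD' ag] := D3 _ _ _ _ hF hD.
  by exists n; split=> //; exact: t3 ht.
- move=> F; rewrite t4; split=> [[n hn]|[m [n [_ _ hn]]]]; last by exists n.
  have [m hm] := D4 n F; exists (maxn m n), n; split=> //; first lia.
  by apply: D2 hm; lia.
Qed.

(** * Closure properties of the lightface classes *)

Lemma Sig_ext k P Q : (forall F, P F <-> Q F) -> Sig k P -> Sig k Q.
Proof.
case: k => [|k] h /=.
  by move=> [th [? ? ? h']]; exists th; split=> // F; rewrite -h.
by move=> [R [hR h']]; exists R; split=> // F; rewrite -h.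
Qed.

Lemma Sig_sub k P T : Rec T -> Sig k P -> Sig k (fun F => P (T F)).
Proof.
elim: k P T => [|k IH] P T hT /=; first exact: S0_sub.
move=> [Q [hQ hP]]; exists (fun F => Q (F 0 ::: T (fun i => F i.+1))); split.
  exact: (IH (fun F => ~ Q F) _ (Rec_lift hT)).
by move=> F; rewrite hP.
Qed.

Definition Pi k P := Sig k (fun F => ~ P F).

Definition halfl (f : nat -> nat) : nat -> nat := fun n => f (n + n).
Definition halfr (f : nat -> nat) : nat -> nat := fun n => f (n + n).+1.

Lemma halves f g : exists h, halfl h = f /\ halfr h = g.
Proof.
exists (fun n => if odd n then g n./2 else f n./2); split; apply/funext => n.
  by rewrite /halfl addnn odd_double doubleK.
by rewrite /halfr addnn /= odd_double /= uphalf_double.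
Qed.

Lemma Rec_split1 : Rec (fun F => halfl (F 0) ::: (fun i => F i.+1)).
Proof. by apply: Rec_cons; [apply: Rec1_tm; rewrite /halfl; ar_tm|exact: Rec_ren]. Qed.

Lemma Rec_split2 : Rec (fun F => halfr (F 0) ::: (fun i => F i.+1)).
Proof. by apply: Rec_cons; [apply: Rec1_tm; rewrite /halfr; ar_tm|exact: Rec_ren]. Qed.

(** Proved together because the matrix is a complement of the level below, where the two connectives
    change places. *)
Lemma Sig_and_or k P Q : Sig k P -> Sig k Q ->
  Sig k (fun F => P F /\ Q F) /\ Sig k (fun F => P F \/ Q F).
Proof.
elim: k P Q => [|k IH] P Q /=.
  move=> [th [t1 t2 t3 t4]] [th' [t1' t2' t3' t4']]; split.
    exists (fun m F => th m F /\ th' m F); split.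
    - exact: Ar_and.
    - by move=> m n F mn [? ?]; split; [exact: t2 mn _|exact: t2' mn _].
    - by move=> m F F' hF [? ?]; split; [exact: t3 hF _|exact: t3' hF _].
    - move=> F; rewrite t4 t4'; split=> [[[m hm] [n hn]]|[n [? ?]]]; last by split; exists n.
      by exists (maxn m n); split; [apply: t2 hm|apply: t2' hn]; lia.
  exists (fun m F => th m F \/ th' m F); split.
  - exact: Ar_or.
  - by move=> m n F mn [h|h]; [left; exact: t2 mn _|right; exact: t2' mn _].
  - by move=> m F F' hF [h|h]; [left; exact: t3 hF _|right; exact: t3' hF _].
  - move=> F; rewrite t4 t4'; split=> [[[n]|[n]] ?|[n [?|?]]]; try by exists n; tauto.
      by left; exists n.
    by right; exists n.
move=> [P' [hP' eP]] [Q' [hQ' eQ]]; split; last first.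
  exists (fun F => P' F \/ Q' F); split.
    by apply: Sig_ext (proj1 (IH _ _ hP' hQ')) => F; tauto.
  by move=> F; rewrite eP eQ; split=> [[[f ?]|[f ?]]|[f [?|?]]];
    [exists f; left|exists f; right|left; exists f|right; exists f].
exists (fun F => P' (halfl (F 0) ::: (fun i => F i.+1)) /\
                 Q' (halfr (F 0) ::: (fun i => F i.+1))); split.
  have := proj2 (IH _ _ (Sig_sub Rec_split1 hP') (Sig_sub Rec_split2 hQ')).
  by apply: Sig_ext => F; rewrite not_andE.
move=> F; rewrite eP eQ; split=> [[[f hf] [g hg]]|[h [? ?]]].
  by have [h [? ?]] := halves f g; subst; exists h.
by split; [exists (halfl h)|exists (halfr h)].
Qed.

Lemma Sig_and k P Q : Sig k P -> Sig k Q -> Sig k (fun F => P F /\ Q F).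
Proof. by move=> hP hQ; case: (Sig_and_or hP hQ). Qed.

Lemma Sig_or k P Q : Sig k P -> Sig k Q -> Sig k (fun F => P F \/ Q F).
Proof. by move=> hP hQ; case: (Sig_and_or hP hQ). Qed.

(** At level 0 a stage depends on finitely many values of the witness, so the quantifier is
    arithmetical; above, two witnesses merge by interleaving. *)
Lemma Sig_exf k P : Sig k P -> Sig k (fun F => exists f, P (f ::: F)).
Proof.
case: k => [|k] /=.
  move=> [th [t1 t2 t3 t4]]; exists (fun m F => exists f, th m (f ::: F)); split.
  - apply: (Ar_exf t1) => F e b h; exists (e 0) => b' hb.
    by apply: t3 h; exact: agree_scons.
  - by move=> m n F mn [f hf]; exists f; exact: t2 hf.
  - by move=> m F F' hF [f hf]; exists f; apply: t3 hf; exact: agree_scons.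
  - move=> F; split=> [[f /t4 [n hn]]|[n [f hf]]]; first by exists n, f.
    by exists f; apply/t4; exists n.
move=> [Q [hQ e]].
exists (fun F => Q (halfl (F 0) ::: halfr (F 0) ::: (fun i => F i.+1))); split.
  apply: (Sig_sub _ hQ); apply: Rec_cons; last exact: Rec_split2.
  by apply: Rec1_tm; rewrite /halfl; ar_tm.
move=> F; split=> [[g /e [f hf]]|[h hh]].
  by have [h [? ?]] := halves f g; subst; exists h.
by exists (halfr h); apply/e; exists (halfl h).
Qed.

(** Environments hold functions only, so a number enters them as a constant function. *)
Definition cst (n : nat) : nat -> nat := fun=> n.

Lemma Sig_exn k P : Sig k P -> Sig k (fun F => exists n, P (cst n ::: F)).
Proof.
case: k => [|k] /=.
  move=> [th [t1 t2 t3 t4]].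
  exists (fun m F => exists n, n <= m /\ th m (cst n ::: F)); split.
  - apply: Ar_exn; apply: Ar_and; first by ar.
    apply: (Ar_sub (G := fun F e => cst (e 0) ::: F) (P := fun F e => th (e 1) F)).
      by case=> [|i]; rewrite /cst /=; ar.
    exact: (Ar_ren S t1).
  - by move=> m n F mn [j [le hf]]; exists j; split; [exact: leq_trans mn|exact: t2 hf].
  - by move=> m F F' hF [j [le hf]]; exists j; split=> //; apply: t3 hf; exact: agree_scons.
  - move=> F; split=> [[f /t4 [n hn]]|[n [f [_ hf]]]]; last by exists f; apply/t4; exists n.
    by exists (maxn n f), f; split; [lia|apply: t2 hn; lia].
move=> [Q [hQ e]].
exists (fun F => Q ((fun n => F 0 n.+1) ::: cst (F 0 0) ::: (fun i => F i.+1))); split.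
  apply: (Sig_sub _ hQ); apply: Rec_cons; first by apply: Rec1_tm; ar_tm.
  by apply: Rec_cons; [apply: Rec1_tm; rewrite /cst; ar_tm|exact: Rec_ren].
move=> F; split=> [[n /e [f hf]]|[h hh]].
  by exists (n ::: f).
by exists (h 0); apply/e; eexists; exact: hh.
Qed.

(** A polynomial pairing, hence a term of the arithmetical language; injective but not onto. *)
Definition J (a b : nat) : nat := (a + b) * (a + b) + a.

Lemma J_inj a b a' b' : J a b = J a' b' -> a = a' /\ b = b'.
Proof.
rewrite /J => h; suff : a + b = a' + b' by lia.
by case: (ltngtP (a + b) (a' + b')) => // lt; nia.
Qed.

Definition sec (d : nat -> nat) (n : nat) : nat -> nat := fun m => d (J n m).

Lemma sec_surj (u : nat -> nat -> nat) : exists d, forall n, sec d n = u n.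
Proof.
have [g hg] : exists g : nat -> nat * nat, forall n m, g (J n m) = (n, m).
  have dec (c : nat) : exists g : nat * nat,
      (exists nm : nat * nat, c = J nm.1 nm.2) -> c = J g.1 g.2.
    by have [[nm h]|h] := EM (exists nm : nat * nat, c = J nm.1 nm.2); [exists nm|exists (0, 0)].
  have [g hg] := choice dec.
  exists g => n m; have /hg/J_inj [] : exists nm : nat * nat, J n m = J nm.1 nm.2 by exists (n, m).
  by case: (g _) => a b /= -> ->.
by exists (fun c => u (g c).1 (g c).2) => n; apply/funext => m; rewrite /sec hg.
Qed.

(** Countable choice packs the witnesses for all [n] into one function. Level 0 is excluded: open
    sets are not closed under countable intersections. *)
Lemma Sig_alln k P : Sig k.+1 P -> Sig k.+1 (fun F => forall n, P (cst n ::: F)).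
Proof.
move=> [Q [hQ e]].
exists (fun F => forall n, Q (sec (F 0) n ::: cst n ::: (fun i => F i.+1))); split.
  have hT : Rec (fun F => sec (F 1) (F 0 0) ::: cst (F 0 0) ::: (fun i => F i.+2)).
    apply: Rec_cons; first by apply: Rec1_tm; rewrite /sec /J; ar_tm.
    by apply: Rec_cons; [apply: Rec1_tm; rewrite /cst; ar_tm|exact: Rec_ren].
  apply: Sig_ext (Sig_exn (Sig_sub hT hQ)) => F.
  by split=> [[n hn] h|/existsNP [n hn]]; [exact: hn (h n)|exists n].
move=> F; split=> [h|[d hd] n]; last by apply/e; exists (sec d n).
have [u hu] := choice (fun n => proj1 (e _) (h n)).
by have [d hd] := sec_surj u; exists d => n; rewrite hd; exact: hu.
Qed.

(** Finite dependence passes to the complement, so dummy quantifiers lift [M] through all levels. *)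
Lemma Sig_local k (M : env -> Prop) n0 : Ar (fun F e => M F) ->
  (forall F F', agree n0 F F' -> M F -> M F') -> Sig k M.
Proof.
elim: k M => [|k IH] M h loc /=.
  exists (fun m F => n0 <= m /\ M F); split.
  - by ar.
  - by move=> m n F mn [le hM]; split=> //; exact: leq_trans mn.
  - by move=> m F F' hF [le hM]; split=> //; apply: loc hM; exact: agreeW hF.
  - by move=> F; split=> [hM|[n []]//]; exists n0.
exists (fun F => M (fun i => F i.+1)); split.
  apply: (IH (fun F => ~ M (fun i => F i.+1))).
    apply: Ar_not; apply: (Ar_sub (G := fun F e i => F i.+1) (P := fun F e => M F)) => //.
    by move=> i; ar.
  by move=> F F' hF hM; apply: contra_not hM; apply: loc => i j jn; rewrite hF.
move=> F; split=> [hM|[f //]]; by exists (cst 0).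
Qed.

(** * Formulas defining the lightface classes *)

Lemma holds_not k F p :
  (Sigma1_holds k F (ar_not p) <-> ~ Pi1_holds k F p) /\
  (Pi1_holds k F (ar_not p) <-> ~ Sigma1_holds k F p).
Proof.
elim: k F => //= k IH F; split; split.
- by move=> [f h] h'; exact: proj1 (proj2 (IH (f :: F))) h (h' f).
- by move=> /existsNP [f h]; exists f; exact: proj2 (proj2 (IH (f :: F))) h.
- by move=> h [f h']; exact: proj1 (proj1 (IH (f :: F))) (h f) h'.
- by move=> h f; apply: (proj2 (proj1 (IH (f :: F)))) => h'; apply: h; exists f.
Qed.

(** An [S0] set is arithmetical, being a number quantifier in front of [th]; each further level adds
    a function variable 0 and a negation, which is pushed into the matrix. *)
Lemma Sig_form k P : Sig k P ->
  exists p, forall F, P (nthf F) <-> Sigma1_holds k F p.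
Proof.
elim: k P => [|k IH] P /=.
  move=> [th [t1 _ _ e]]; have [q hq] : Ar (fun F e => P F).
    apply: (@Ar_ext (fun F e => exists n, th n F)); first by move=> F _; rewrite e.
    by apply: Ar_exn.
  by exists q => F; rewrite (hq _ (nth 0 [::])) ar_holds_fev.
move=> [Q [/IH [p hp] e]]; exists (ar_not p) => F; rewrite e.
have hQ f : Q (f ::: nthf F) <-> Pi1_holds k (f :: F) (ar_not p).
  have := hp (f :: F); rewrite /nthf nth_cons_scons => h.
  by rewrite (proj2 (holds_not _ _ _)) -h; split=> [? //|/contrapT].
by split=> -[f /hQ h]; exists f.
Qed.

Lemma Pi_form k P : Pi k P ->
  exists p, forall F, P (nthf F) <-> Pi1_holds k F p.
Proof.
move=> /Sig_form [p hp]; exists (ar_not p) => F.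
by rewrite (proj2 (holds_not _ _ _)) -hp; split=> [? //|/contrapT].
Qed.

(** * Relation with the boldface classes *)

Lemma Sig_dual k P : Sig k P -> Sig k.+1 (fun F => ~ P F).
Proof.
move=> h; exists (fun F => ~ P (fun i => F i.+1)); split.
  by apply: Sig_ext (Sig_sub (Rec_ren S) h) => F; split=> [? //|/contrapT].
by move=> F; split=> [?|[f //]]; exists (cst 0).
Qed.

(** The sets containing a cylinder around [f] form a filter that converges to [f] in each
    coordinate, hence in the product topology, so it contains all neighbourhoods of [f]. *)
Lemma prod_topology_cylinder (D : topologicalType)
    (f : prod_topology (fun _ : nat => D)) (W : set (prod_topology (fun _ : nat => D))) :
  nbhs f W -> exists m, forall g, (forall j, j < m -> f j = g j) -> W g.
Proof.
pose G := [set V : set (prod_topology (fun _ : nat => D)) |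
  exists m, forall g, (forall j, j < m -> f j = g j) -> V g].
have FG : Filter G.
  split=> [|P Q [m hm] [n hn]|P Q PQ [m hm]]; first by exists 0.
    exists (maxn m n) => g hg; split.
      by apply: hm => j jm; apply: hg; lia.
    by apply: hn => j jm; apply: hg; lia.
  by exists m => g /hm /PQ.
suff: {ptws, G --> f} by move=> h /h.
apply/cvg_sup => i U [B [[C oC <-] Bf] sub].
by exists i.+1 => g hg; apply: sub; rewrite /= -hg.
Qed.

Lemma prod_topology_discrete (D : discreteTopologicalType) (j : nat)
    (f : prod_topology (fun _ : nat => D)) :
  \forall g \near f, g j = f j.
Proof.
have h := @proj_continuous nat (fun _ => D) j f.
exact: (h [set f j] (discrete_set1 _)).
Qed.

(** Continuity into environments. Only finitely many variables may depend on the point, so that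
    agreement up to a bound is a finite intersection of neighbourhoods. *)
Definition reading (T : topologicalType) (v : T -> env) : Prop :=
  (exists r, forall x x' i, r <= i -> v x i = v x' i) /\
  forall i j x, \forall x' \near x, v x' i j = v x i j.

Lemma reading_agree (T : topologicalType) (v : T -> env) : reading v ->
  forall m x, \forall x' \near x, agree m (v x) (v x').
Proof.
move=> [[r hr] hv] m x.
have : \forall x' \near x, forall ij : 'I_r * 'I_m, v x' ij.1 ij.2 = v x ij.1 ij.2.
  by apply: filter_forall => ij; exact: hv.
apply: filterS => x' h i j jm; have [ir|ri] := ltnP i r; last by rewrite (hr x x').
by rewrite (h (Ordinal ir, Ordinal jm)).
Qed.

Lemma reading_cons (T : topologicalType) (v : T -> env) : reading v ->
  reading (fun xf : T * baire_space => xf.2 ::: v xf.1).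
Proof.
move=> [[r hr] hv]; split; first by exists r.+1 => x x' [//|i] /=; exact: hr.
move=> [|i] j [x f] /=.
  have h : \forall g \near (f : baire_space), g j = f j by exact: prod_topology_discrete.
  exact: (@cvg_snd T baire_space (nbhs x) (nbhs f) _ _ h).
exact: (@cvg_fst T baire_space (nbhs x) (nbhs f) _ _ (hv i j x)).
Qed.

Lemma Sig_bold k (T : topologicalType) (v : T -> env) P : reading v -> Sig k P ->
  bold_Sigma1 k [set x | P (v x)].
Proof.
elim: k T v P => [|k IH] T v P hv /=.
  move=> [th [t1 t2 t3 t4]]; rewrite openE => x /= /t4 [n hn].
  rewrite /interior; have := reading_agree hv n x; apply: filterS => x' ag.
  by apply/t4; exists n; exact: t3 hn.
move=> [Q [hQ e]]; exists [set xf | Q (xf.2 ::: v xf.1)]; split.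
  exact: (IH _ _ (fun F => ~ Q F) (reading_cons hv)).
by apply/seteqP; split=> x /=; rewrite e.
Qed.

(** * Universal sets *)

(* The real in position 0 lists cylinders: if its value at [J 0 c] is m.+1,
   then its values at [J i.+1 (J c j)], for j < m, prescribe the first m values
   of the i-th variable, for i < r. *)
Definition Un0 (r : nat) (F : env) : Prop :=
  exists c m, F 0 (J 0 c) = m.+1 /\
    forall i, i < r -> forall j, j < m -> F 0 (J i.+1 (J c j)) = F i.+1 j.

Fixpoint Un (k r : nat) (F : env) : Prop :=
  if k is k'.+1 then exists f, ~ Un k' r.+1 (F 0 ::: f ::: (fun i => F i.+1))
  else Un0 r F.

Lemma Ar_all_ltn r (P : nat -> env -> (nat -> nat) -> Prop) :
  (forall i, Ar (P i)) -> Ar (fun F e => forall i, i < r -> P i F e).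
Proof.
move=> h; elim: r => [|r IH]; first by apply: Ar_ext Ar_true.
apply: Ar_ext (Ar_and IH (h r)) => F e; split=> [[h1 h2] i|k].
  by rewrite ltnS leq_eqVlt => /orP[/eqP -> //|]; exact: h1.
by split=> [i ir|]; apply: k => //; exact: ltnW.
Qed.

Lemma Sig_Un k r : Sig k (Un k r).
Proof.
elim: k r => [|k IH] r; last first.
  exists (fun F => ~ Un k r.+1 (F 1 ::: F 0 ::: (fun i => F i.+2))); split=> //.
  have hT : Rec (fun F => F 1 ::: F 0 ::: (fun i => F i.+2)).
    by do 2 (apply: Rec_cons; first by apply: Rec1_tm; ar_tm); exact: Rec_ren.
  by apply: Sig_ext (Sig_sub hT (IH r.+1)) => F; split=> [? //|/contrapT].
exists (fun N F => exists c m, (c <= N /\ m <= N) /\ (J 0 c < N /\ F 0 (J 0 c) = m.+1) /\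
    forall i, i < r -> forall j, j < m ->
      J i.+1 (J c j) < N /\ F 0 (J i.+1 (J c j)) = F i.+1 j); split.
- rewrite /J; do 2 apply: Ar_exn; apply: Ar_and; first by ar.
  by apply: Ar_and; [ar|apply: Ar_all_ltn => i; ar].
- move=> m n F mn [c [k [[h1 h2] [[h3 h4] h5]]]]; exists c, k.
  split; first by split; exact: leq_trans mn.
  split; first by split=> //; exact: leq_trans mn.
  by move=> i ir j jk; have [h6 h7] := h5 i ir j jk; split=> //; exact: leq_trans mn.
- move=> m F F' hF [c [k [[h1 h2] [[h3 h4] h5]]]]; exists c, k.
  split=> //; split; first by split=> //; rewrite -hF.
  move=> i ir j jk; have [h6 h7] := h5 i ir j jk; split=> //.
  by rewrite -!hF //; exact: leq_trans h2.
- move=> F; split=> [[c [m [h1 h2]]]|[N [c [m [_ [[_ h1] h2]]]]]]; last first.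
    by exists c, m; split=> // i ir j jm; case: (h2 i ir j jm).
  pose N := \max_(i < r) \max_(j < m) (J i.+1 (J c j)).+1.
  exists (maxn (maxn c m) (maxn (J 0 c).+1 N)), c, m; split; first by split; lia.
  split; first by split=> //; lia.
  move=> i ir j jm; split; last exact: h2.
  rewrite !leq_max; apply/orP; right; apply/orP; right; rewrite /N.
  apply: leq_trans (leq_bigmax (Ordinal ir)).
  exact: (leq_bigmax (F := fun j : 'I_m => (J i.+1 (J c j)).+1) (Ordinal jm)).
Qed.

(** The counterpart of [reading]: the topology of [T] is no finer than the one induced by the first
    [r] functions, so unions of cylinders give all open sets. *)
Definition embeds (r : nat) (T : topologicalType) (v : T -> env) : Prop :=
  forall A : set T, open A -> forall x, A x ->
    exists m, forall x', (forall i j, i < r -> j < m -> v x i j = v x' i j) -> A x'.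

Lemma embeds_cons r (T : topologicalType) (v : T -> env) : embeds r v ->
  embeds r.+1 (fun xf : T * baire_space => xf.2 ::: v xf.1).
Proof.
move=> hv A oA [x f] Axf.
have : nbhs (x, f) A by exact: open_nbhs_nbhs.
move=> [[U V] [/= nU nV] sub].
have [m hm] := prod_topology_cylinder nV.
have [n hn] := hv _ (open_interior U) x nU.
exists (maxn m n) => -[x' f'] h; apply: sub; split=> /=.
  by apply: interior_subset; apply: hn => i j ir jn; apply: (h i.+1); lia.
by apply: hm => j jm; apply: (h 0); lia.
Qed.

Lemma sec2_surj (u : nat -> nat -> nat -> nat) :
  exists d, forall i c j, d (J i (J c j)) = u i c j.
Proof.
have [g hg] := choice (fun i => sec_surj (u i)); have [d hd] := sec_surj g.
by exists d => i c j; rewrite -(hg i c) -(hd i).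
Qed.

Lemma Un_universal k r (T : topologicalType) (v : T -> env) (A : set T) :
  embeds r v -> bold_Sigma1 k A -> exists a, forall x, A x <-> Un k r (a ::: v x).
Proof.
elim: k r T v A => [|k IH] r T v A hv /=; last first.
  move=> [B [/(IH _ _ _ _ (embeds_cons hv)) [a ha] ->]]; exists a => x /=.
  split=> -[f hf]; exists f; first by move=> /(proj2 (ha (x, f))) h; exact: h hf.
  by apply: contrapT => nB; exact: hf (proj1 (ha (x, f)) nB).
move=> oA.
(* The code lists exactly the cylinders contained in [A]; in [hd], 0 marks the numbers that
   contribute none, hence the shift of the length by one. *)
pose good (mw : nat * seq (seq nat)) := forall x',
  (forall i j, i < r -> j < mw.1 -> nth 0 (nth [::] mw.2 i) j = v x' i j) -> A x'.
pose hd (c : nat) : nat := if unpickle c is Some mw then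
   if `[< good mw >] then mw.1.+1 else 0 else 0.
pose tl (i c j : nat) : nat := if @unpickle (nat * seq (seq nat))%type c is Some mw then
   nth 0 (nth [::] mw.2 i) j else 0.
have [d2 hd2] := sec2_surj tl.
have [a ha] := sec_surj (fun i => if i is i'.+1 then sec d2 i' else hd).
have a0 c : a (J 0 c) = hd c by rewrite -[LHS]/(sec a 0 c) ha.
have aS i c j : a (J i.+1 (J c j)) = tl i c j.
  by rewrite -[LHS]/(sec a i.+1 (J c j)) ha /sec hd2.
exists a => x; split=> [Ax|].
  have [m hm] := hv _ oA x Ax.
  pose w := mkseq (fun i => mkseq (v x i) m) r.
  exists (pickle (m, w)), m; rewrite /= a0 /hd pickleK; split.
    case: asboolP => // -[] x' /= h; apply: hm => i j ir jm.
    by rewrite -h // /w nth_mkseq // nth_mkseq.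
  by move=> i ir j jm; rewrite aS /tl pickleK /= /w nth_mkseq // nth_mkseq.
move=> [c [m [/=]]]; rewrite a0 /hd.
case e: (unpickle c) => [mw|//]; case: asboolP => // gd [mE] h.
by apply: gd => i j ir jm; rewrite -h -?mE // aS /tl e.
Qed.

(** * Strategies as reals *)

(** A code for the first [n] values of [b]; the successor separates nonempty sequences from the
    empty one, so the length can be recovered. *)
Fixpoint trace (b : nat -> nat) (n : nat) : nat :=
  if n is n'.+1 then (J (trace b n') (b n')).+1 else 0.

Lemma trace_agree b b' n : (forall j, j < n -> b j = b' j) -> trace b n = trace b' n.
Proof.
elim: n => //= n IH h; rewrite (h n) // IH // => j jn; apply: h; exact: ltnW.
Qed.

Lemma trace_inj b b' n n' : trace b n = trace b' n' ->
  n = n' /\ forall j, j < n -> b j = b' j.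
Proof.
elim: n n' => [|n IH] [|n'] //= [/J_inj [/IH [<- h] e]]; split=> // j.
by rewrite ltnS leq_eqVlt => /orP[/eqP ->|/h].
Qed.

(* The reply to [b] of the strategy coded by [t]; its n-th move depends on the
   first n + d moves of [b], so d = 0 for player I and d = 1 for player II. *)
Definition act (d : nat) (t b : nat -> nat) : nat -> nat :=
  fun n => t (trace b (n + d)).

Definition lip (d : nat) (f : (nat -> nat) -> nat -> nat) : Prop :=
  forall n b b', (forall j, j < n + d -> b j = b' j) -> f b n = f b' n.

Lemma lip_act d t : lip d (act d t).
Proof. by move=> n b b' h; rewrite /act (trace_agree h). Qed.

(** The code of a finite sequence determines it, so the move can be attached to the code; numbers
    that code nothing get 0. *)
Lemma lip_code d f : lip d f -> exists t, forall b, act d t b = f b.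
Proof.
move=> hf.
have dec c : exists v, forall b n, c = trace b (n + d) -> f b n = v.
  have [[[b n] ->]|h] := EM (exists bn, c = trace bn.1 (bn.2 + d)).
    exists (f b n) => b' n' /= /trace_inj [/addIn <- h]; exact/esym/hf.
  by exists 0 => b n e; case: h; exists (b, n).
have [t ht] := choice dec; exists t => b; apply/funext => n.
by rewrite /act -(ht _ b n).
Qed.

Lemma Ar_trace q : Ar (fun F e => trace (F q) (e 0) = e 1).
Proof.
(* Function variable 0 is the history of the recursion up to [e 0]. Only finitely many of its values
   matter, as [Ar_exf] requires. *)
pose P F (e : nat -> nat) := F 0 0 = 0 /\
  ((forall j, j < e 0 -> F 0 j.+1 = (J (F 0 j) (F q.+1 j)).+1) /\ F 0 (e 0) = e 1).
apply: (@Ar_ext (fun F e => exists g, P (g ::: F) e)).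
  move=> F e; split=> [[g [/= g0 [gS <-]]]|h]; last by exists (trace (F q)).
  have : forall n, n <= e 0 -> trace (F q) n = g n; last exact.
  by elim=> [|n IH] le /=; [rewrite g0|rewrite IH ?gS // ltnW].
apply: Ar_exf; first by rewrite /P /J; ar.
move=> F e b [/= b0 [bS be]]; exists (e 0).+1 => b' hb; split; first by rewrite /= -hb.
split=> /= [j jn|]; last by rewrite -hb.
by rewrite -!hb ?bS //; exact: ltnW.
Qed.

Lemma Rec1_act p q d : Rec1 (fun F => act d (F p) (F q)).
Proof.
have hA : Ar (fun F e => trace (F q) (e 0 + d) = e 1).
  apply: (@Ar_ext (fun F e => exists n, n = e 0 + d /\ trace (F q) n = e 1)).
    by move=> F e; split=> [[n [->]]|]; last by exists (e 0 + d).
  apply: Ar_exn; apply: Ar_and; first by ar.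
  exact: (Ar_ren (fun i => if i is 0 then 0 else i.+1) (Ar_trace q)).
split.
  apply: (@Ar_ext (fun F e => exists c, trace (F q) (e 0 + d) = c /\ F p c = e 1)).
    by move=> F e; split=> [[c [<-]]|]; last by eexists; split; first reflexivity.
  apply: Ar_exn; apply: Ar_and; last by ar.
  exact: (Ar_ren (fun i => if i is 0 then 1 else 0) hA).
exists (fun m n F => n + d <= m /\ forall j, j < n -> trace (F q) (j + d) < m); split.
- apply: Ar_and; first by ar.
  apply: (@Ar_ext (fun F e => forall j, j < e 1 ->
      exists c, trace (F q) (j + d) = c /\ c < e 0)).
    move=> F e; split=> h j /h; first by case=> c [->].
    by move=> lt; eexists; split; first reflexivity.
  apply: Ar_all; apply: Ar_imp; first by ar.
  apply: Ar_exn; apply: Ar_and; last by ar.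
  exact: (Ar_ren (fun i => if i is 0 then 1 else 0) hA).
- move=> m m' n F mm [h h']; split; first exact: leq_trans mm.
  by move=> j /h' lt; exact: leq_trans mm.
- move=> m n F F' hF [le h].
  have e j : j < n -> trace (F q) (j + d) = trace (F' q) (j + d).
    by move=> jn; apply: trace_agree => l lj; apply: hF; lia.
  split; first by split=> // j jn; rewrite -e ?h.
  by move=> j jn; rewrite /act -e // hF ?h.
- move=> n F; exists (maxn (n + d) (\max_(j < n) (trace (F q) (j + d)).+1)).
  split=> [|j jn]; first exact: leq_maxl.
  rewrite leq_max; apply/orP; right.
  exact: (leq_bigmax (F := fun j : 'I_n => (trace (F q) (j + d)).+1) (Ordinal jn)).
Qed.

(** Each value needs only strictly earlier values of another sequence, so all sequences grow
    simultaneously: the iterates [A m] are stable at positions below [m]. *)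
Lemma lip0_fixpoints (I : Type) (s : I -> I) (g : I -> (nat -> nat) -> nat -> nat) :
  (forall i, lip 0 (g i)) -> exists a : I -> nat -> nat, forall i, a i = g i (a (s i)).
Proof.
move=> hg; pose A := fix A m i := if m is m'.+1 then g i (A m' (s i)) else cst 0.
have hA m : forall m' i j, j < m -> j < m' -> A m i j = A m' i j.
  elim: m => [//|m IH] [//|m'] i j jm jm' /=; apply: hg => l; rewrite addn0 => lj.
  by apply: IH; lia.
exists (fun i j => A j.+1 i j) => i; apply/funext => j /=; apply: hg => l.
by rewrite addn0 => lj; exact: (hA j l.+1 (s i) l).
Qed.

(** * Plays against a fixed strategy, and determinacy in terms of Lipschitz maps *)

Section Play.
Variables (who : bool) (s : strategy) (b : nat -> nat).

Fixpoint play_prefix (n : nat) : seq nat :=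
  if n is n'.+1 then
    rcons (play_prefix n')
      (if odd n' == who then s (play_prefix n') else b n'./2)
  else [::].

Definition play : baire_space := fun n =>
  if odd n == who then s (play_prefix n) else b n./2.

Lemma play_prefixE n : play_prefix n = mkseq play n.
Proof. by elim: n => //= n IH; rewrite -/(play n) mkseqS IH. Qed.

Lemma play_strategy n : odd n = who -> play n = s (mkseq play n).
Proof. by move=> h; rewrite -play_prefixE /play h eqxx. Qed.

Lemma play_opponent n : odd n != who -> play n = b n./2.
Proof. by move=> /negbTE h; rewrite /play h. Qed.

End Play.

(** Before the move of index n, player I has seen n moves of the opponent and player II n + 1;
    [who], read as a number, is this difference. *)
Lemma lip_play (who : bool) s : lip who (fun b n => play who s b (n.*2 + who)).
Proof.
move=> n b b' h; rewrite /play; case: ifP => [_|]; last first.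
  by rewrite oddD odd_double /= oddb eqxx.
congr s; have : forall m, m <= n.*2 + who -> play_prefix who s b m = play_prefix who s b' m.
  elim=> //= m IH lt; rewrite IH; last exact: ltnW.
  congr rcons; case: ifP => // /negbT ow; apply: h.
  by rewrite -divn2 ltn_divLR //; have := odd_double_half m; lia.
exact.
Qed.

Lemma determinacy (W : (nat -> nat) -> (nat -> nat) -> Prop) : PD ->
  projective [set z : baire_space | W (fun n => z n.*2) (fun n => z n.*2.+1)] ->
  (exists f, lip 0 f /\ forall b, W (f b) b) \/
  (exists f, lip 1 f /\ forall a, ~ W a (f a)).
Proof.
move=> pd /pd [[s hs]|[s hs]]; [left|right].
  exists (fun b n => play false s b (n.*2 + false)); split; first exact: (@lip_play false s).
  move=> b; have /= := hs (play false s b).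
  have fl : follows_I s (play false s b).
    by move=> n /negbTE; exact: play_strategy.
  move=> /(_ fl); congr (W _ _); apply/funext => n; first by rewrite addn0.
  by rewrite play_opponent /= ?odd_double //= uphalf_double.
exists (fun b n => play true s b (n.*2 + true)); split; first exact: (@lip_play true s).
move=> b; have /= := hs (play true s b).
have fl : follows_II s (play true s b) by move=> n; exact: play_strategy.
move=> /(_ fl); apply: contra_not; congr (W _ _); apply/funext => n; last by rewrite addn1.
by rewrite play_opponent /= ?odd_double //= doubleK.
Qed.

(** * The prewellordering property *)

(** A norm is given by its prewellordering, not by ordinals; least elements of nonempty sets express
    wellfoundedness and totality at once. *)
Definition norm (P : env -> Prop) (le : env -> env -> Prop) : Prop :=
  (forall x y z, P x -> P y -> P z -> le x y -> le y z -> le x z) /\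
  forall X : env -> Prop, (exists x, X x) -> (forall x, X x -> P x) ->
    exists m, X m /\ forall x, X x -> le m x.

(* In [lestar] and [ltstar], points outside P have infinite norm. *)
Definition lestar (P : env -> Prop) (le : env -> env -> Prop) x y : Prop :=
  P x /\ (P y -> le x y).

Definition ltstar (P : env -> Prop) (le : env -> env -> Prop) x y : Prop :=
  P x /\ (P y -> ~ le y x).

(* A pair of environments is interleaved into one. *)
Definition evs (F : env) : env := fun i => F i.*2.
Definition ods (F : env) : env := fun i => F i.*2.+1.

Definition normed (C : (env -> Prop) -> Prop) (P : env -> Prop) : Prop :=
  exists le, [/\ norm P le, C (fun F => lestar P le (evs F) (ods F))
               & C (fun F => ltstar P le (evs F) (ods F))].

Lemma norm_total P le x y : norm P le -> P x -> P y -> le x y \/ le y x.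
Proof.
move=> [_ h] Px Py; have [||m [[->|->] hm]] := h (fun z => z = x \/ z = y).
- by exists x; left.
- by move=> z [->|->].
- by left; apply: hm; right.
- by right; apply: hm; left.
Qed.

Lemma evs_scons f g F : evs (f ::: g ::: F) = f ::: evs F.
Proof. by apply/funext => -[]. Qed.

Lemma ods_scons f g F : ods (f ::: g ::: F) = g ::: ods F.
Proof. by apply/funext => -[]. Qed.

Definition mix (x y : env) : env := fun i => if odd i then y i./2 else x i./2.

Lemma evs_mix x y : evs (mix x y) = x.
Proof. by apply/funext => i; rewrite /evs /mix odd_double doubleK. Qed.

Lemma ods_mix x y : ods (mix x y) = y.
Proof. by apply/funext => i; rewrite /ods /mix /= odd_double /= uphalf_double. Qed.

(** The norm is the first accepting stage. A stage is decided by finitely many values, so comparing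
    first stages is again open. *)
Lemma normed_S0 P : S0 P -> normed S0 P.
Proof.
move=> [th [t1 t2 t3 t4]]; exists (fun F F' => forall n, th n F' -> th n F).
have hev : Ar (fun F e => th (e 0) (evs F)).
  by apply: (Ar_sub (G := fun F e => evs F) (P := fun F e => th (e 0) F)) => // i;
    rewrite /evs; ar.
have hod : Ar (fun F e => th (e 0) (ods F)).
  by apply: (Ar_sub (G := fun F e => ods F) (P := fun F e => th (e 0) F)) => // i;
    rewrite /ods; ar.
have aev m n F F' : m <= n -> agree n F F' -> th m (evs F) -> th m (evs F').
  by move=> mn hF; apply: t3 => i j jm; apply: hF; exact: leq_trans mn.
have aod m n F F' : m <= n -> agree n F F' -> th m (ods F) -> th m (ods F').
  by move=> mn hF; apply: t3 => i j jm; apply: hF; exact: leq_trans mn.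
split.
- split=> [x y z _ _ _ xy yz n /yz /xy //|X [x0 Xx0] XP].
  have ex : exists n, `[< exists x, X x /\ th n x >].
    by have /t4 [n hn] := XP _ Xx0; exists n; apply/asboolP; exists x0.
  have [n /asboolP [x [Xx hx]] hmin] := ex_minnP ex.
  exists x; split=> // y Xy m hm; apply: t2 hx; apply: hmin.
  by apply/asboolP; exists y.
- exists (fun N F => exists n, n <= N /\ (th n (evs F) /\
      forall m, m < n -> ~ th m (ods F))); split.
  + apply: Ar_exn; apply: Ar_and; first by ar.
    apply: Ar_and; first exact: (Ar_ren (fun i => 0) hev).
    apply: Ar_all; apply: Ar_imp; first by ar.
    by apply: Ar_not; exact: (Ar_ren (fun i => 0) hod).
  + by move=> m n F mn [i [im h]]; exists i; split=> //; exact: leq_trans mn.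
  + move=> N F F' hF [n [nN [h1 h2]]]; exists n; split=> //; split; first exact: aev hF h1.
    by move=> m mn; apply: contra_not (h2 m mn); apply: aod (agree_sym hF); lia.
  + move=> F; split=> [[/t4 [n0 h0] hle]|[N [n [_ [h1 h2]]]]]; last first.
      split; first by apply/t4; exists n.
      move=> _ m hm; apply: t2 h1; rewrite leqNgt; apply/negP => mn; exact: h2 hm.
    have ex : exists n, `[< th n (evs F) >] by exists n0; apply/asboolP.
    have [n /asboolP hn hmin] := ex_minnP ex.
    exists n, n; split=> //; split=> // m mn hm.
    have : n <= m; last lia.
    by apply: hmin; apply/asboolP; apply: hle => //; apply/t4; exists m.
- exists (fun N F => exists n, n <= N /\ (th n (evs F) /\ ~ th n (ods F))); split.
  + apply: Ar_exn; apply: Ar_and; first by ar.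
    apply: Ar_and; first exact: (Ar_ren (fun i => 0) hev).
    by apply: Ar_not; exact: (Ar_ren (fun i => 0) hod).
  + by move=> m n F mn [i [im h]]; exists i; split=> //; exact: leq_trans mn.
  + move=> N F F' hF [n [nN [h1 h2]]]; exists n; split=> //; split; first exact: aev hF h1.
    by apply: contra_not h2; apply: aod (agree_sym hF).
  + move=> F; split=> [[Pe hle]|[N [n [_ [h1 h2]]]]]; last first.
      split; first by apply/t4; exists n.
      by move=> _ h; apply: h2; exact: h.
    have [/hle|nP] := EM (P (ods F)).
      by move=> /existsNP [n /not_implyP [h1 h2]]; exists n, n.
    have /t4 [n hn] := Pe; exists n, n; split=> //; split=> // h.
    by apply: nP; apply/t4; exists n.
Qed.

Lemma Pi_all k R : Sig k R -> Pi k.+1 (fun F => forall t, R (t ::: F)).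
Proof.
move=> h; exists (fun F => ~ R F); split.
  by apply: Sig_ext h => F; split=> [? //|/contrapT].
by move=> F; split=> [/existsNP|[f hf] h']; [|exact: hf].
Qed.

(** The norm of a point is the least norm of its witnesses. Comparison says that some witness for x
    beats every b for y; the quantifier over b is absorbed by the Pi class. *)
Lemma normed_ex k Q P : normed (Pi k) Q ->
  (forall F, P F <-> exists a, Q (a ::: F)) -> normed (Sig k.+1) P.
Proof.
move=> [leQ [[trQ minQ] dle dlt]] hP.
have least y : P y -> exists b, Q (b ::: y) /\
    forall b', Q (b' ::: y) -> leQ (b ::: y) (b' ::: y).
  move=> /hP [b0 hb0].
  have [||m [[b [-> Qb]] hm]] := minQ (fun F => exists b, F = b ::: y /\ Q F).
  - by exists (b0 ::: y), b0.
  - by move=> F [? []].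
  - by exists b; split=> // b' Qb'; apply: hm; exists b'.
have def R : Pi k (fun F => R (evs F) (ods F)) ->
    Sig k.+1 (fun F => exists a, forall b, R (a ::: evs F) (b ::: ods F)).
  move=> h; exists (fun F => forall b, R (F 0 ::: evs (fun i => F i.+1))
    (b ::: ods (fun i => F i.+1))); split=> //.
  have hT : Rec (fun F => F 1 ::: F 0 ::: (fun i => F i.+2)).
    by do 2 (apply: Rec_cons; first by apply: Rec1_tm; ar_tm); exact: Rec_ren.
  apply: Sig_ext (Sig_exf (Sig_sub hT h)) => F /=.
  split=> [[b hb] k'|/existsNP [b hb]].
    by apply: hb; rewrite evs_scons ods_scons; exact: k'.
  by exists b; rewrite evs_scons ods_scons.
exists (fun x y => forall b, Q (b ::: y) -> exists a, Q (a ::: x) /\ leQ (a ::: x) (b ::: y)).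
split.
- split=> [x y z _ _ _ xy yz c Qc|X [x0 Xx0] XP].
    have [b [Qb bc]] := yz _ Qc; have [a [Qa ab]] := xy _ Qb.
    by exists a; split=> //; exact: trQ ab bc.
  have [||m [[a [x [-> [Xx Qa]]]] hm]] :=
    minQ (fun F => exists a x, F = a ::: x /\ (X x /\ Q F)).
  + by have /hP [a Qa] := XP _ Xx0; exists (a ::: x0), a, x0.
  + by move=> F [? [? [_ []]]].
  + by exists x; split=> // y Xy b Qb; exists a; split=> //; apply: hm; exists b, y.
- apply: Sig_ext (def _ dle) => F; set x := evs F; set y := ods F.
  split=> [[a ha]|[Px hle]].
    have Qa : Q (a ::: x) by case: (ha (cst 0)).
    split=> [|_ b Qb]; first by apply/hP; exists a.
    by exists a; split=> //; exact: (proj2 (ha b)).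
  have [a [Qa amin]] := least _ Px; exists a => b; split=> // Qb.
  have [|a' [Qa' le']] := hle _ b Qb; first by apply/hP; exists b.
  exact: trQ (amin _ Qa') le'.
- apply: Sig_ext (def _ dlt) => F; set x := evs F; set y := ods F.
  split=> [[a ha]|[Px hle]].
    have Qa : Q (a ::: x) by case: (ha (cst 0)).
    split=> [|_ h]; first by apply/hP; exists a.
    have [b [Qb le']] := h _ Qa; exact: (proj2 (ha b)) Qb le'.
  have [Py|nPy] := EM (P y); last first.
    have /hP [a Qa] := Px; exists a => b; split=> // Qb _.
    by apply: nPy; apply/hP; exists b.
  have /existsNP [a /not_implyP [Qa h]] := hle Py.
  by exists a => b; split=> // Qb le'; apply: h; exists b.
Qed.

(* [le x y] says that player II wins the game where I plays a, II plays b and II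
   wins iff (a, x) has norm at most that of (b, y). If there were no minimum, I
   would win the games of an infinite sequence of points; playing all his
   strategies against each other gives an infinite descending sequence for the
   norm of Q. In the definition of the norm relations, II winning is replaced by
   I not winning, which is where determinacy is needed. *)
Lemma normed_all k Q P : PD -> normed (Sig k) Q ->
  (forall F, P F <-> forall a, Q (a ::: F)) -> normed (Pi k.+1) P.
Proof.
move=> pd [leQ [nQ dle dlt]] hP; have [trQ minQ] := nQ.
have PQ F a : P F -> Q (a ::: F) by move=> /hP.
have dich x y : (exists f, lip 1 f /\ forall a, lestar Q leQ (a ::: x) (f a ::: y)) \/
    (exists g, lip 0 g /\ forall b, ~ lestar Q leQ (g b ::: x) (b ::: y)).
  have [|[g hg]|[f [hf h]]] :=
      @determinacy (fun a b => ~ lestar Q leQ (a ::: x) (b ::: y)) pd.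
  - exists k.+1.
    (* The fixed points [x] and [y] are parameters of the payoff set, so boldface determinacy is
       used. *)
    pose v (z : baire_space) :=
      (fun n => z n.*2) ::: (fun n => z n.*2.+1) ::: mix x y.
    have rv : reading v.
      split=> [|[|[|i]] j z]; first by exists 2 => z z' [|[|i]].
      + exact: prod_topology_discrete.
      + exact: prod_topology_discrete.
      + exact: filterE.
    have := Sig_bold rv (Sig_dual dle); congr (bold_Sigma1 _ _).
    by apply/funext => z /=; rewrite evs_scons ods_scons evs_mix ods_mix.
  - by right; exists g.
  - by left; exists f; split=> // a; exact: contrapT (h a).
have def d R : Sig k (fun F => R (evs F) (ods F)) ->
    Pi k.+1 (fun F => forall t, exists b, R (act d t b ::: evs F) (b ::: ods F)).
  move=> h.
  have hT : Rec (fun F => act d (F 1) (F 0) ::: F 0 ::: (fun i => F i.+2)).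
    apply: Rec_cons; first exact: Rec1_act.
    by apply: Rec_cons; [apply: Rec1_tm; ar_tm|exact: Rec_ren].
  apply: Sig_ext (Pi_all (Sig_exf (Sig_sub hT h))) => F /=.
  suff e t b : R (evs (act d t b ::: b ::: F)) (ods (act d t b ::: b ::: F)) <->
      R (act d t b ::: evs F) (b ::: ods F).
    split; apply: contra_not => h' t; have [b hb] := h' t; exists b;
    [exact: (proj2 (e t b))|exact: (proj1 (e t b))].
  by rewrite evs_scons ods_scons.
exists (fun x y => exists f, lip 1 f /\ forall a, leQ (a ::: x) (f a ::: y)); split.
- split=> [x y z Px Py Pz [f [lf hf]] [g [lg hg]]|X [x0 Xx0] XP].
    exists (fun a => g (f a)); split=> [n b b' h|a].
      by apply: lg => j jn; apply: lf => l lj; apply: h; lia.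
    by apply: trQ (hf a) (hg (f a)); exact: PQ.
  apply: contrapT => nomin.
  have step m : exists x, X m -> X x /\
      ~ exists f, lip 1 f /\ forall a, leQ (a ::: m) (f a ::: x).
    have [Xm|nX] := EM (X m); last by exists m.
    apply: contrapT => h; apply: nomin; exists m; split=> // x Xx.
    by apply: contrapT => h'; apply: h; exists x.
  have [nx hnx] := choice step; pose x i := iter i nx x0.
  have Xx i : X (x i) by elim: i => //= i /hnx [].
  have strat i : exists g, lip 0 g /\ forall b, ~ lestar Q leQ (g b ::: x i) (b ::: x i.+1).
    have [[f [lf hf]]|//] := dich (x i) (x i.+1).
    case: (proj2 (hnx _ (Xx i))); exists f; split=> // a.
    by apply: (proj2 (hf a)); exact/PQ/XP/Xx.
  have [g hg] := choice strat.
  have [a ha] := lip0_fixpoints S (fun i => proj1 (hg i)).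
  have Qa i : Q (a i ::: x i) by exact/PQ/XP/Xx.
  have [||m [[i ->] hm]] := minQ (fun F => exists i, F = a i ::: x i).
  + by exists (a 0 ::: x 0), 0.
  + by move=> F [i ->].
  + apply: (proj2 (hg i) (a i.+1)); rewrite -ha; split=> // _.
    by apply: hm; exists i.+1.
- apply: Sig_ext (def 0 _ dle) => F; set x := evs F; set y := ods F.
  suff e : (forall t, exists b, lestar Q leQ (act 0 t b ::: x) (b ::: y)) <->
      lestar P (fun x y => exists f, lip 1 f /\ forall a, leQ (a ::: x) (f a ::: y)) x y.
    by split; apply: contra_not => /e.
  split=> [h|[Px hle] t].
    split=> [|Py].
      (* Against the strategy that plays [a] regardless of the opponent, the hypothesis puts
         [a ::: x] in [Q]. *)
      apply/hP => a; have [t ht] := @lip_code 0 (fun=> a) (fun _ _ _ _ => erefl).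
      by have [b [+ _]] := h t; rewrite ht.
    have [[f [lf hf]]|[g [lg hg]]] := dich x y.
      by exists f; split=> // a; apply: (proj2 (hf a)); exact: PQ.
    by have [t ht] := lip_code lg; have [b] := h t; rewrite ht => /hg.
  have Qx a : Q (a ::: x) by exact: PQ.
  have [Py|nPy] := EM (P y); last first.
    have /existsNP [b nb] : ~ forall b, Q (b ::: y) by rewrite -hP.
    by exists b; split.
  have [f [lf hf]] := hle Py.
  (* The fixed point is the side of player II in the play of [f] against [t]. *)
  have [] := @lip0_fixpoints unit id (fun _ b => f (act 0 t b)).
    by move=> _ n b b' h; apply: lf => j jn; apply: lip_act => l lj; apply: h; lia.
  move=> b /(_ tt) eb; exists (b tt); split=> // _.
  by rewrite [X in leQ _ (X ::: _)]eb; exact: hf.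
(* Strict comparison says that II has no winning strategy in the game for [y] and [x]. The roles are
   exchanged, so the move on the side of [x] is the reply, whence the delay 1. *)
- apply: Sig_ext (def 1 _ dlt) => F; set x := evs F; set y := ods F.
  suff e : (forall t, exists b, ltstar Q leQ (act 1 t b ::: x) (b ::: y)) <->
      ltstar P (fun x y => exists f, lip 1 f /\ forall a, leQ (a ::: x) (f a ::: y)) x y.
    by split; apply: contra_not => /e.
  split=> [h|[Px hle] t].
    split=> [|Py [f [lf hf]]].
      apply/hP => a; have [t ht] := @lip_code 1 (fun=> a) (fun _ _ _ _ => erefl).
      by have [b [+ _]] := h t; rewrite ht.
    have [t ht] := lip_code lf; have [b [_ hb]] := h t.
    by move: hb; rewrite ht => hb; apply: hb (hf b); exact: PQ.
  have Qx a : Q (a ::: x) by exact: PQ.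
  have [Py|nPy] := EM (P y); last first.
    have /existsNP [b nb] : ~ forall b, Q (b ::: y) by rewrite -hP.
    by exists b; split.
  apply: contrapT => h; apply: (hle Py); exists (act 1 t); split=> [|b]; first exact: lip_act.
  by apply: contrapT => nle; apply: h; exists b; split.
Qed.

(** The property alternates: games carry it from Sigma at even levels to Pi one level up, least
    witnesses from there to Sigma at the next. *)
Theorem prewellordering n : PD ->
  (forall P, Sig n.*2 P -> normed (Sig n.*2) P) /\
  (forall P, Pi n.*2.+1 P -> normed (Pi n.*2.+1) P).
Proof.
move=> pd.
have step k : (forall P, Sig k P -> normed (Sig k) P) ->
    forall P, Pi k.+1 P -> normed (Pi k.+1) P.
  move=> h P [Q [/h hQ e]]; apply: (normed_all pd hQ) => F.
  split=> [PF a Qa|h' ]; first by case: (proj2 (e F)) => //; exists a.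
  by apply: contrapT => /e [a]; exact: h'.
elim: n => [|n [IH1 IH2]].
  have h0 : forall P, Sig 0 P -> normed (Sig 0) P by exact: normed_S0.
  by split=> //; exact: step.
have hS : forall P, Sig n.+1.*2 P -> normed (Sig n.+1.*2) P.
  move=> P [Q [hQ e]]; exact: (normed_ex (IH2 _ hQ)).
by split=> //; exact: step.
Qed.

(** * The largest stage of a relation that is an equivalence relation *)

(* [dom q p] stands for: not (q <* p). *)
Section Generated.
Variables (X : Type) (R : X * X -> Prop) (dom : X * X -> X * X -> Prop).

Inductive gen (s : X * X) : X * X -> Prop :=
  | gen_start p : dom s p -> gen s p
  | gen_dom q p : gen s q -> dom q p -> gen s p
  | gen_sym q u v : gen s q -> dom q (v, u) -> gen s (u, v)
  | gen_trans q u v z : gen s q -> dom q (u, z) -> dom q (z, v) -> gen s (u, v).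

Definition safe (u v : X) : Prop := u = v \/ forall p, gen (u, v) p -> R p.

Hypothesis dom_refl : forall p, dom p p.
Hypothesis dom_R : forall p q, R q -> dom q p -> R p.
Hypothesis dom_total : forall p q, R p -> R q -> dom p q \/ dom q p.

Lemma gen_gen s q p : gen s q -> gen q p -> gen s p.
Proof.
move=> sq; elim=> [r /(gen_dom sq) //|r r' _ h d|r u v _ h d|r u v z _ h d d'].
- exact: gen_dom h d.
- exact: gen_sym h d.
- exact: gen_trans h d d'.
Qed.

(** Safety passes to every generated pair, and (v, u) is generated from (u, v). For transitivity,
    whichever of (u, v) and (v, w) has the larger norm generates (u, w). *)
Lemma safe_equivalence : Equivalence safe.
Proof.
split=> [u|u v [->|h]|u v w [-> //|h] [<-|h']]; first by left.
- by left.
- right=> p hp; apply: h; apply: gen_gen hp.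
  by apply: (@gen_sym _ (u, v)); [exact/gen_start/dom_refl|exact: dom_refl].
- by right.
have key q : dom q (u, v) -> dom q (v, w) -> (forall p, gen q p -> R p) -> safe u w.
  move=> d d' hq; right=> p hp; apply: hq; apply: gen_gen hp.
  by apply: (@gen_trans _ q _ _ v) => //; exact/gen_start/dom_refl.
have Ruv : R (u, v) by apply/h/gen_start/dom_refl.
have Rvw : R (v, w) by apply/h'/gen_start/dom_refl.
by case: (dom_total Ruv Rvw) => d; [apply: (key (u, v))|apply: (key (v, w))].
Qed.

Lemma safe_id : Equivalence (fun u v => R (u, v)) ->
  forall u v, safe u v <-> R (u, v).
Proof.
move=> [rR sR tR] u v; split=> [[->|h]|Ruv]; [exact: rR|exact/h/gen_start/dom_refl|].
right=> p; elim=> [q|q r _|q x y _|q x y z _]; first exact: dom_R.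
- exact: dom_R.
- by move=> Rq /(dom_R Rq) /sR.
- by move=> Rq /(dom_R Rq) xz /(dom_R Rq) zy; exact: tR xz zy.
Qed.

(* By totality of the norm one previous pair suffices in each rule, so that
   derivations can be linear and are coded by a sequence. *)
Definition chain (s : X * X) (d : nat -> X * X) (z : nat -> X) : Prop :=
  dom s (d 0) /\ forall i,
    dom (d i) (d i.+1) \/ dom (d i) ((d i.+1).2, (d i.+1).1) \/
    (dom (d i) ((d i.+1).1, z i.+1) /\ dom (d i) (z i.+1, (d i.+1).2)).

Lemma gen_chain s p : gen s p <-> exists d z i, chain s d z /\ d i = p.
Proof.
split=> [|[d [z [i [[d0 dS] <-]]]]]; last first.
  elim: i => [|i IH]; first exact: gen_start.
  case: (dS i) => [|[|[]]]; first exact: gen_dom.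
    by case: (d i.+1) => u v /=; exact: gen_sym.
  by case: (d i.+1) => u v /=; exact: gen_trans.
have extend d z i q x : chain s d z ->
    (dom (d i) q \/ dom (d i) (q.2, q.1) \/
     (dom (d i) (q.1, x) /\ dom (d i) (x, q.2))) ->
    exists d' z' j, chain s d' z' /\ d' j = q.
  (* Past its new entry the chain repeats [q], which reflexivity allows, so chains need no
     length. *)
  move=> [d0 dS] step; exists (fun j => if j <= i then d j else q).
  exists (fun j => if j <= i then z j else x), i.+1; rewrite ltnn; split=> //.
  split=> // j; have [ji|ij|->] := ltngtP j i.
  - exact: dS.
  - by left.
  - exact: step.
elim=> [q h|q r _ [d [z [i [c <-]]]] h|q u v _ [d [z [i [c <-]]]] h
  |q u v x _ [d [z [i [c <-]]]] h h'].
- by exists (fun=> q), (fun=> q.1), 0; split=> //; split=> // i; left.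
- by apply: (extend d z i r r.1) => //; left.
- by apply: (extend d z i _ u) => //; right; left.
- by apply: (extend d z i _ x) => //; right; right.
Qed.

End Generated.

Definition tri (a u v : nat -> nat) : env := a ::: u ::: v ::: (fun=> cst 0).

Definition dominates (W : env -> Prop) (le : env -> env -> Prop) (a : nat -> nat)
    (q p : (nat -> nat) * (nat -> nat)) : Prop :=
  ~ ltstar W le (tri a q.1 q.2) (tri a p.1 p.2).

(* A point of the Cantor space codes the functions whose graph it contains: it
   may code several functions, or none, and its section of the universal set is
   the intersection of the corresponding equivalence relations. *)
Definition graph_of (t a : nat -> nat) : Prop := forall n, t (J n (a n)) = 1.

Definition safe_of (W : env -> Prop) (le : env -> env -> Prop) (a : nat -> nat) :=
  safe (fun p => W (tri a p.1 p.2)) (dominates W le a).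

Section SafePart.
Variables (W : env -> Prop) (le : env -> env -> Prop) (a : nat -> nat).
Hypothesis nW : norm W le.

Lemma dominates_refl p : dominates W le a p p.
Proof. by move=> [Wp h]; have [] := norm_total nW Wp Wp; exact: h. Qed.

Lemma dominates_in p q : W (tri a q.1 q.2) -> dominates W le a q p -> W (tri a p.1 p.2).
Proof. by move=> Wq h; apply: contrapT => nW'; apply: h; split. Qed.

Lemma dominates_total p q : W (tri a p.1 p.2) -> W (tri a q.1 q.2) ->
  dominates W le a p q \/ dominates W le a q p.
Proof.
move=> Wp Wq; have [h|h] := norm_total nW Wp Wq; [right|left] => -[_]; exact.
Qed.

Lemma safe_of_equivalence : Equivalence (safe_of W le a).
Proof. exact: safe_equivalence dominates_refl dominates_total. Qed.

Lemma safe_of_id : Equivalence (fun u v => W (tri a u v)) ->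
  forall u v, safe_of W le a u v <-> W (tri a u v).
Proof.
by move=> h; apply: safe_id h; [exact: dominates_refl|exact: dominates_in].
Qed.

End SafePart.

(** * Complexity of the complement of the universal set *)

Lemma Rec_zero : Rec (fun _ _ => cst 0).
Proof.
split=> [i|]; first by rewrite /cst; ar.
by exists (fun _ _ _ => True); split=> //; ar.
Qed.

Lemma Sig_dominates k W le (a u v u' v' : env -> nat -> nat) :
  Pi k (fun F => ltstar W le (evs F) (ods F)) ->
  Rec1 a -> Rec1 u -> Rec1 v -> Rec1 u' -> Rec1 v' ->
  Sig k (fun F => dominates W le (a F) (u F, v F) (u' F, v' F)).
Proof.
move=> h ra ru rv ru' rv'.
have hT : Rec (fun F => a F ::: a F ::: u F ::: u' F ::: v F ::: v' F ::: (fun=> cst 0)).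
  by do 6 apply: Rec_cons => //; exact: Rec_zero.
by apply: Sig_ext (Sig_sub hT h) => F; rewrite !evs_scons !ods_scons.
Qed.

Definition refuted (W : env -> Prop) (le : env -> env -> Prop) (F : env) : Prop :=
  (exists n, F 1 n <> F 2 n) /\ exists a, graph_of (F 0) a /\
    exists p, gen (dominates W le a) (F 1, F 2) p /\ ~ W (tri a p.1 p.2).

Lemma refutedE W le F :
  ~ refuted W le F <-> forall a, graph_of (F 0) a -> safe_of W le a (F 1) (F 2).
Proof.
split=> [h a ga|h [[n hn] [a [/h ha [p [gp nWp]]]]]]; last first.
  by case: ha => [e|ha]; [apply: hn; rewrite e|exact/nWp/ha].
have [e|ne] := EM (F 1 = F 2); [by left|right=> p gp].
apply: contrapT => nWp; apply: h; split; last by exists a; split=> //; exists p.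
by apply: contrapT => h; apply: ne; apply/funext => n; apply: contrapT => h'; apply: h; exists n.
Qed.


Lemma Sig_neq k (g h : env -> nat) :
  Tm (fun F e => g F) -> Tm (fun F e => h F) -> Sig k (fun F => g F <> h F).
Proof.
move=> tg th; have hT : Rec (fun F => cst (g F) ::: cst (h F) ::: (fun i => F i)).
  by do 2 (apply: Rec_cons; first exact: Rec1_tm); exact: (Rec_ren id).
apply: (Sig_sub (P := fun F => F 0 0 <> F 1 0) hT).
by apply: (@Sig_local _ _ 1) => [|F F' hF]; [ar|rewrite !hF].
Qed.

Lemma Sig_eq1 k (g : env -> nat) :
  Tm (fun F e => g F) -> Sig k (fun F => g F = 1).
Proof.
move=> tg; have hT : Rec (fun F => cst (g F) ::: (fun i => F i)).
  by apply: Rec_cons; [exact: Rec1_tm|exact: (Rec_ren id)].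
apply: (Sig_sub (P := fun F => F 0 0 = 1) hT).
by apply: (@Sig_local _ _ 1) => [|F F' hF]; [ar|rewrite !hF].
Qed.

Lemma Sig_refuted k W le : norm W le -> Pi k.+1 W ->
  Pi k.+1 (fun F => ltstar W le (evs F) (ods F)) -> Sig k.+1 (refuted W le).
Proof.
move=> nW hW hlt.
have chainE a := gen_chain (@dominates_refl W le a nW).
have rt p n : Tm (fun F e => n F) -> Rec1 (fun F => sec (F p) (n F)).
  by move=> [t ht]; apply: Rec1_tm; rewrite /sec /J; ar_tm; exists t => F e; exact: ht.
have rv p : Rec1 (fun F => F p) by apply: Rec1_tm; ar_tm.
(* Variables 0 to 3 are the witnesses: intermediate points, second components and first components
   of the chain, then the decoded code. Variables 4 to 6 are the index and the two points. *)
pose core (G : env) := graph_of (G 4) (G 3) /\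
  (dominates W le (G 3) (G 5, G 6) (sec (G 2) 0, sec (G 1) 0) /\
  (forall i, dominates W le (G 3) (sec (G 2) i, sec (G 1) i)
        (sec (G 2) i.+1, sec (G 1) i.+1) \/
      (dominates W le (G 3) (sec (G 2) i, sec (G 1) i)
        (sec (G 1) i.+1, sec (G 2) i.+1) \/
      (dominates W le (G 3) (sec (G 2) i, sec (G 1) i)
        (sec (G 2) i.+1, sec (G 0) i.+1) /\
       dominates W le (G 3) (sec (G 2) i, sec (G 1) i)
        (sec (G 0) i.+1, sec (G 1) i.+1))))) /\
  exists i, ~ W (tri (G 3) (sec (G 2) i) (sec (G 1) i)).
have hcore : Sig k.+1 core.
  have tm0 : Tm (fun F e => F 0 0) by ar_tm.
  have tmS : Tm (fun F e => (F 0 0).+1) by ar_tm.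
  have tmO : Tm (fun (F : env) (e : nat -> nat) => 0) by ar_tm.
  apply: Sig_and; [|apply: Sig_and; [apply: Sig_and|]].
  - apply: (Sig_alln (P := fun F => F 5 (J (F 0 0) (F 4 (F 0 0))) = 1)).
    by apply: Sig_eq1; rewrite /J; ar_tm.
  - by apply: Sig_dominates => //; apply: rt.
  - pose s p (F : env) := sec (F p) (F 0 0); pose s' p (F : env) := sec (F p) (F 0 0).+1.
    apply: (Sig_alln (P := fun F =>
      dominates W le (F 4) (s 3 F, s 2 F) (s' 3 F, s' 2 F) \/
      (dominates W le (F 4) (s 3 F, s 2 F) (s' 2 F, s' 3 F) \/
      (dominates W le (F 4) (s 3 F, s 2 F) (s' 3 F, s' 1 F) /\
       dominates W le (F 4) (s 3 F, s 2 F) (s' 1 F, s' 2 F))))).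
    apply: Sig_or; last apply: Sig_or; last apply: Sig_and;
      by apply: Sig_dominates => //; apply: rt.
  - apply: (Sig_exn (P := fun F => ~ W (tri (F 4) (sec (F 3) (F 0 0)) (sec (F 2) (F 0 0))))).
    apply: (Sig_sub _ hW); apply: Rec_cons => //.
    by do 2 (apply: Rec_cons; first exact: rt); exact: Rec_zero.
have hneq : Sig k.+1 (fun F => exists n, F 1 n <> F 2 n).
  by apply: (Sig_exn (P := fun F => F 2 (F 0 0) <> F 3 (F 0 0))); apply: Sig_neq; ar_tm.
have := Sig_and hneq (Sig_exf (Sig_exf (Sig_exf (Sig_exf hcore)))).
apply: Sig_ext => F; split=> -[hn].
  move=> [a [U [V [Z [ga [[c0 cS] [i nWi]]]]]]]; split=> //; exists a; split=> //.
  exists (sec U i, sec V i); split=> //; apply/chainE.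
  by exists (fun j => (sec U j, sec V j)), (sec Z), i; split.
move=> [a [ga [p [/chainE [d [z [i [[c0 cS] <-]]]] nWp]]]]; split=> //.
have [U hU] := sec_surj (fun j => (d j).1).
have [V hV] := sec_surj (fun j => (d j).2).
have [Z hZ] := sec_surj z.
have e j : (sec U j, sec V j) = d j by rewrite hU hV; case: (d j).
exists a, U, V, Z; split=> //; split; last by exists i; rewrite /= hU hV.
split=> [|j] /=; first by rewrite e.
by have := cS j; rewrite !e hU hV hZ.
Qed.

(** * Points of the Cantor space among functions, and the universal equivalence relation *)

Definition bits (f : nat -> nat) : cantor_space := fun n => f n != 0.

Lemma bits_cantor_fun x : bits (cantor_fun x) = x.
Proof. by apply/funext => n; rewrite /bits /cantor_fun; case: (x n). Qed.

Lemma Rec1_bits i : Rec1 (fun F => cantor_fun (bits (F i))).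
Proof.
rewrite /cantor_fun /bits; split.
  apply: (@Ar_ext (fun F e => (F i (e 0) = 0 /\ e 1 = 0) \/ (~ F i (e 0) = 0 /\ e 1 = 1))).
    move=> F e; case: eqVneq => h /=; split; try by [tauto|case=> [[]|[]]].
    + by move=> <-; left.
    + by case=> [[e0]|[_ ->] //]; rewrite e0 in h.
    + by move=> <-; right; split=> //; exact/eqP.
  by ar.
exists (fun m n F => n <= m); split.
- by ar.
- by move=> m m' n _ mm nm; exact: leq_trans mm.
- by move=> m n F F' hF nm; split=> // j jn; rewrite hF //; exact: leq_trans nm.
- by move=> n F; exists n.
Qed.

Definition cantor2_env (p : cantor_space * cantor_space) : env :=
  cantor_fun p.1 ::: cantor_fun p.2 ::: (fun=> cst 0).

Lemma embeds_cantor2 : embeds 2 cantor2_env.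
Proof.
move=> A oA [x y] Axy.
have : nbhs (x, y) A by exact: open_nbhs_nbhs.
move=> [[U V] [/= nU nV] sub].
have [m hm] := prod_topology_cylinder nU.
have [n hn] := prod_topology_cylinder nV.
have inj : injective nat_of_bool by case=> -[].
exists (maxn m n) => -[x' y'] h; apply: sub; split=> /=.
  by apply: hm => j jm; apply/inj/(h 0) => //; lia.
by apply: hn => j jn; apply/inj/(h 1) => //; lia.
Qed.

(** Chains run through arbitrary functions, so the points are first reduced to 0-1 values: an
    equivalence relation on the Cantor space pulls back along [bits] to one on all functions. *)
Definition universal_Pi (k : nat) (F : env) : Prop :=
  ~ Un k 2 (F 0 ::: cantor_fun (bits (F 1)) ::: cantor_fun (bits (F 2)) :::
            (fun i => F i.+3)).

Lemma Pi_universal_Pi k : Pi k (universal_Pi k).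
Proof.
have hT : Rec (fun F => F 0 ::: cantor_fun (bits (F 1)) ::: cantor_fun (bits (F 2)) :::
    (fun i => F i.+3)).
  apply: Rec_cons; first by apply: Rec1_tm; ar_tm.
  by do 2 (apply: Rec_cons; first exact: Rec1_bits); exact: Rec_ren.
by apply: Sig_ext (Sig_sub hT (Sig_Un k 2)) => F; split=> [? //|/contrapT].
Qed.

Lemma reading_cantor3 t : reading (fun p : cantor_space * cantor_space =>
  nthf [:: cantor_fun t; cantor_fun p.1; cantor_fun p.2]).
Proof.
split=> [|i j [x y]].
  by exists 3 => p p' i i3; rewrite /nthf !nth_default.
case: i => [|[|[|i]]].
- exact: filterE.
- have h : \forall g \near (x : cantor_space), g j = x j by exact: prod_topology_discrete.
  have h2 : \forall p \near (x, y), p.1 j = x j.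
    exact: (@cvg_fst cantor_space cantor_space (nbhs x) (nbhs y) _ _ h).
  by apply: filterS h2 => p /= e; rewrite /nthf /= /cantor_fun e.
- have h : \forall g \near (y : cantor_space), g j = y j by exact: prod_topology_discrete.
  have h2 : \forall p \near (x, y), p.2 j = y j.
    exact: (@cvg_snd cantor_space cantor_space (nbhs x) (nbhs y) _ _ h).
  by apply: filterS h2 => p /= e; rewrite /nthf /= /cantor_fun e.
- by apply: filterE => p; rewrite /nthf /= !nth_nil.
Qed.

Theorem theorem1p9 : PD -> forall n : nat,
  exists E : set (cantor_space * cantor_space * cantor_space),
    [/\ light_Pi1 (2 * n + 1) E,
        forall t : cantor_space,
          bold_Pi1 (2 * n + 1) (cross_section E t) /\
          equivalence_set (cross_section E t)
      & forall R : set (cantor_space * cantor_space),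
          bold_Pi1 (2 * n + 1) R -> equivalence_set R ->
          exists t : cantor_space, R = cross_section E t].
Proof.
move=> pd n; rewrite mul2n addn1; set k := n.*2.+1.
have [le [nW _ hlt]] := proj2 (prewellordering n pd) _ (Pi_universal_Pi k).
have hS := Sig_refuted nW (Pi_universal_Pi k) hlt.
pose ev (t x y : cantor_space) := nthf [:: cantor_fun t; cantor_fun x; cantor_fun y].
pose E := [set p : cantor_space * cantor_space * cantor_space |
  ~ refuted (universal_Pi k) le (ev p.1.1 p.1.2 p.2)].
have EP t x y : cross_section E t (x, y) <-> forall a, graph_of (cantor_fun t) a ->
    safe_of (universal_Pi k) le a (cantor_fun x) (cantor_fun y).
  exact: (refutedE _ _ (ev t x y)).
exists E; split.
- have /Pi_form [p hp] : Pi k (fun F => ~ refuted (universal_Pi k) le F).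
    by apply: Sig_ext hS => F; split=> [? //|/contrapT].
  by exists p => t x y; rewrite -hp.
- move=> t; split.
    have := Sig_bold (reading_cantor3 t) hS; congr (bold_Sigma1 _ _).
    by apply/seteqP; split=> -[x y] /= h; [|exact: contrapT].
  split=> [x|x y /EP h|x y z /EP h /EP h']; apply/EP => a ga;
    have [r s tr] := @safe_of_equivalence _ _ a nW.
  + exact: r.
  + exact/s/h.
  + by apply: tr (h _ ga) (h' _ ga).
- move=> R bR eR; have [a ha] := Un_universal embeds_cantor2 bR.
  have WR u v : universal_Pi k (tri a u v) <-> R (bits u, bits v).
    have -> : universal_Pi k (tri a u v) = ~ Un k 2 (a ::: cantor2_env (bits u, bits v)) by [].
    by rewrite -ha; split=> [/contrapT|? //].
  have eW : Equivalence (fun u v => universal_Pi k (tri a u v)).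
    case: eR => r s tr; split=> [u|u v|u v w]; rewrite !WR; [exact: r|exact: s|exact: tr].
  (* The characteristic function of the graph of [a] codes [a] alone, so the intersection over coded
     functions has a single term. *)
  pose t : cantor_space := fun c => `[< exists i, c = J i (a i) >].
  have ta b : graph_of (cantor_fun t) b <-> b = a.
    rewrite /graph_of /cantor_fun /t; split=> [h|-> i].
      apply/funext => i; have := h i; case: asboolP => // -[j /J_inj [<- ->]] //.
    by case: asboolP => // -[]; exists i.
  exists t; apply/seteqP; split=> -[x y].
    move=> Rxy; apply/EP => b /ta ->.
    by apply/(safe_of_id nW eW)/WR; rewrite !bits_cantor_fun.
  move=> /EP /(_ a (proj2 (ta a) erefl)) /(safe_of_id nW eW)/WR.
  by rewrite !bits_cantor_fun.
Qed.
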